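(* Let $\mathbb{F}$ be a finite field and let $k$ be a constant. Every infinite sequence $M_1, M_2, \ldots$ of skew-symmetric or symmetric matrices over $\mathbb{F}$ of rank-width at most $k$ has a pair $i<j$ such that $M_i$ is isomorphic to a principal submatrix of the Schur complement $(M_j/A)$ for some nonsingular principal submatrix $A$ of $M_j$.
   Context: A $V\times V$ matrix is skew-symmetric if $A=-A^t$ and all diagonal entries are zero (even in characteristic 2). Two square matrices $A_1$ ($V_1\times V_1$) and $A_2$ ($V_2\times V_2$) are isomorphic if there is a bijection $f:V_1\to V_2$ with the $(i,j)$ entry of $A_1$ equal to the $(f(i),f(j))$ entry of $A_2$. If $M=\begin{pmatrix} A & B\\ C & D\end{pmatrix}$ with rows/columns indexed by $Y$ and $V\setminus Y$ and $A=M[Y]$ nonsingular, the Schur complement is $(M/A)=D-CA^{-1}B$ (if $Y=\emptyset$, $(M/A)=M$). A rank-decomposition of a $V\times V$ matrix $A$ is a pair $(T,\mathcal L)$ of a subcubic tree $T$ and a bijection $\mathcal L$ from $V$ to the leaves of $T$; the width of an edge $e$ is $\operatorname{rk} A[\mathcal L^{-1}(X_e),\mathcal L^{-1}(Y_e)]$ where $(X_e,Y_e)$ is the partition of leaves given by the components of $T\setminus e$; the width of the decomposition is the maximum edge width, and the rank-width is the minimum width over all rank-decompositions (0 if $|V|\le 1$). *)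

(* Defs.v *)
From HB Require Import structures.
From mathcomp Require Import all_boot all_order all_algebra.
From mathcomp Require Import boolp.

Set Implicit Arguments.
Unset Strict Implicit.
Unset Printing Implicit Defensive.

Import GRing.Theory.
Local Open Scope ring_scope.

Section Matrices.
Variable F : fieldType.

Definition symmetric_matrix n (A : 'M[F]_n) : Prop := A = A^T.

(* The vanishing diagonal is a separate requirement because of
   characteristic 2. *)
Definition skew_symmetric_matrix n (A : 'M[F]_n) : Prop :=
  A = - A^T /\ forall i, A i i = 0.

Definition matrix_isomorphic m n (A : 'M[F]_m) (B : 'M[F]_n) : Prop :=
  exists f : 'I_m -> 'I_n, bijective f /\ forall i j, A i j = B (f i) (f j).

(* A[X, Y]; rows and columns are renumbered along the increasing enumerations
   of X and Y. *)
Definition submatrix n (A : 'M[F]_n) (X Y : {set 'I_n}) : 'M[F]_(#|X|, #|Y|) :=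
  \matrix_(i, j) A (enum_val i) (enum_val j).

Definition principal_submatrix n (A : 'M[F]_n) (Y : {set 'I_n}) : 'M[F]_#|Y| :=
  submatrix A Y Y.

(* (M / M[Y]); meaningful when M[Y] is nonsingular. *)
Definition schur_complement n (M : 'M[F]_n) (Y : {set 'I_n}) :
    'M[F]_#|~: Y| :=
  submatrix M (~: Y) (~: Y) -
    submatrix M (~: Y) Y *m invmx (principal_submatrix M Y) *m
      submatrix M Y (~: Y).

End Matrices.

Section Trees.
Variables (T : finType) (e : rel T).

Definition degree (x : T) : nat := #|[set y | e x y]|.

Definition is_leaf (x : T) : bool := degree x == 1%N.

Definition is_tree : Prop :=
  [/\ (0 < #|T|)%N, symmetric e, irreflexive e,
      (forall x y, connect e x y)
    & (forall c : seq T, ucycle e c -> (size c <= 2)%N)].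

Definition is_subcubic_tree : Prop :=
  is_tree /\ forall x, (degree x <= 3)%N.

Definition delete_edge (u v : T) : rel T :=
  fun x y => [&& e x y, (x, y) != (u, v) & (x, y) != (v, u)].

End Trees.

Record rank_decomposition (n : nat) : Type := RankDecomposition {
  rd_vertex : finType;
  rd_adj : rel rd_vertex;
  rd_subcubic : is_subcubic_tree rd_adj;
  rd_leaf : 'I_n -> {x : rd_vertex | is_leaf rd_adj x};
  rd_leaf_bij : bijective rd_leaf
}.

Section RankWidth.
Variables (F : fieldType) (n : nat).

(* The indices whose leaf lies in the component of u in T \ uv. *)
Definition edge_side (D : rank_decomposition n) (u v : rd_vertex D) :
    {set 'I_n} :=
  [set i | connect (delete_edge (@rd_adj n D) u v) u (val (rd_leaf D i))].

Definition edge_width (A : 'M[F]_n) (D : rank_decomposition n)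
    (u v : rd_vertex D) : nat :=
  \rank (submatrix A (edge_side u v) (edge_side v u)).

(* Each edge is visited in both orientations; the two ranks agree for symmetric
   and for skew-symmetric A. *)
Definition decomposition_width (A : 'M[F]_n) (D : rank_decomposition n) : nat :=
  (\max_(p : rd_vertex D * rd_vertex D | @rd_adj n D p.1 p.2)
     edge_width A p.1 p.2)%N.

End RankWidth.

(* A tree may be presented by a parent map that strictly decreases a rank. *)
Section ParentTree.
Variables (T : finType) (p : T -> T) (r : T -> nat) (root : T).
Hypothesis rP : forall x, x != root -> (r (p x) < r x)%N.
Hypothesis pr : p root = root.

Definition parent_adj : rel T :=
  fun x y => (x != y) && ((p x == y) || (p y == x)).

Lemma parent_adj_sym : symmetric parent_adj.
Proof. by move=> x y; rewrite /parent_adj eq_sym orbC. Qed.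

Lemma parent_adj_lower x y : parent_adj x y -> (r y <= r x)%N -> p x = y.
Proof.
case/andP=> xy /orP[/eqP // | /eqP yx] le.
have y0 : y != root.
  by apply: contraNneq xy => y0; rewrite -yx y0 pr.
by have := rP y0; rewrite yx ltnNge le.
Qed.

Lemma parent_adj_tree : is_tree parent_adj.
Proof.
have csym : connect_sym parent_adj.
  exact: sym_connect_sym parent_adj_sym.
have toroot x : connect parent_adj x root.
  have [m] := ubnP (r x); elim: m x => // m IH x lt.
  have [-> // | x0] := eqVneq x root.
  have lt' := rP x0.
  apply: connect_trans (IH (p x) _); last exact: leq_trans lt' _.
  apply: connect1; rewrite /parent_adj eqxx andbT.
  by apply: contraTneq lt' => <-; rewrite ltnn.
split.
- by apply/card_gt0P; exists root.
- exact: parent_adj_sym.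
- by move=> x; rewrite /parent_adj eqxx.
- by move=> x y; apply: connect_trans (toroot x) _; rewrite csym.
move=> c /andP[cyc uc]; case Ec: c => [//|x0 s]; rewrite -Ec.
have x0c : x0 \in c by rewrite Ec mem_head.
have [x xc xmax] : exists2 x, x \in c & forall y, y \in c -> (r y <= r x)%N.
  by case: (arg_maxnP r x0c) => x xc H; exists x => // y /H.
have nx : p x = next c x.
  by apply: parent_adj_lower; [exact: next_cycle | apply: xmax; rewrite mem_next].
have px : p x = prev c x.
  apply: parent_adj_lower; last by apply: xmax; rewrite mem_prev.
  by rewrite parent_adj_sym; exact: prev_cycle.
have nn : next c (next c x) = x by rewrite -nx px next_prev.
have [i c' Hrot] := rot_to xc.
have nrot y : next c y = next (x :: c') y by rewrite -Hrot next_rot.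
have {uc} uc : uniq (x :: c') by rewrite -Hrot rot_uniq.
rewrite -(size_rot i) Hrot.
case: c' {Hrot} nrot uc => [//|a [//|b c']] nrot.
move: nn; rewrite !nrot /= !eqxx.
by case: eqP => [-> | _] => [_ | ->]; rewrite /= !inE eqxx ?orbT.
Qed.

End ParentTree.

(* Any two or more indices can be placed at the leaves of a caterpillar: a path
   (i, false) with a pendant vertex (i, true) attached to each of its vertices. *)
Section Caterpillar.
Variable m : nat.
Local Notation n := m.+2.
Local Notation V := ('I_n * bool)%type.

Definition caterpillar_parent (x : V) : V :=
  if x.2 then (x.1, false) else (inord x.1.-1, false).

Local Notation cat := (parent_adj caterpillar_parent).

Lemma caterpillar_tree : is_tree cat.
Proof.
apply: (@parent_adj_tree _ _ (fun x : V => x.1.*2 + x.2)%N (ord0, false)).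
- case=> i [] /=; rewrite /caterpillar_parent /= => ni.
    by rewrite addn0 addn1.
  have i0 : (0 < i)%N.
    rewrite lt0n; apply: contraNneq ni => i0.
    by apply/eqP; congr pair; apply: val_inj.
  rewrite !addn0 ltn_double inordK ?ltn_predL //.
  exact: leq_ltn_trans (leq_pred _) (ltn_ord i).
- by congr pair; apply: val_inj; rewrite /= inordK.
Qed.

Lemma caterpillar_true i : [set y | cat (i, true) y] = [set (i, false)].
Proof.
apply/setP=> -[j b]; rewrite !inE /parent_adj /caterpillar_parent /=.
by case: b; rewrite !xpair_eqE /= ?andbF ?andbT ?orbF 1?eq_sym.
Qed.

Lemma caterpillar_leaf (x : V) : is_leaf cat x = x.2.
Proof.
case: x => i [] /=; first by rewrite /is_leaf /degree caterpillar_true cards1.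
apply/negbTE; rewrite /is_leaf /degree neq_ltn; apply/orP; right.
pose j : 'I_n := if (i : nat) == 0%N then inord 1 else inord i.-1.
have H : [set (i, true); (j, false)] \subset [set y | cat (i, false) y].
  apply/subsetP=> y; rewrite !inE => /orP[] /eqP ->.
    by rewrite /parent_adj /caterpillar_parent !xpair_eqE /= ?eqxx ?andbF ?orbT.
  rewrite /parent_adj /caterpillar_parent !xpair_eqE /= ?andbT /j.
  case: (eqVneq (i : nat) 0%N) => [i0 | ]; last first.
    rewrite -lt0n => i0; rewrite eqxx andbT -val_eqE /= inordK; last first.
      exact: leq_ltn_trans (leq_pred _) (ltn_ord i).
    by rewrite neq_ltn ltn_predL i0 orbT.
  rewrite -!val_eqE /= !inordK //= ?i0 //.
by apply: leq_trans (subset_leq_card H); rewrite cards2 xpair_eqE andbF.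
Qed.

Lemma caterpillar_subcubic : is_subcubic_tree cat.
Proof.
split; first exact: caterpillar_tree.
case=> i [] ; rewrite /degree; first by rewrite caterpillar_true cards1.
have H : [set y | cat (i, false) y] \subset
    [set (i, true); (inord i.-1, false); (inord i.+1, false)].
  apply/subsetP=> -[j b]; rewrite !inE /parent_adj /caterpillar_parent.
  rewrite !xpair_eqE /=; case: b => /=; rewrite ?andbF ?andbT ?orbF /=.
    by rewrite xpair_eqE => /andP[].
  rewrite xpair_eqE andbT.
  case/andP=> ij /orP[/eqP -> | /eqP Ej]; first by rewrite eqxx.
  have vi : (i : nat) = j.-1.
    rewrite -Ej inordK //.
    exact: leq_ltn_trans (leq_pred _) (ltn_ord j).
  have j0 : (0 < j)%N.
    by rewrite lt0n; apply: contraNneq ij => j0; rewrite -val_eqE /= vi j0.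
  by apply/orP; right; rewrite -val_eqE /= vi prednK // inordK.
apply: leq_trans (subset_leq_card H) _.
apply: leq_trans (leq_card_setU _ _) _.
by rewrite cards1 addn1 ltnS cards2; case: (_ != _).
Qed.

Definition caterpillar_label (i : 'I_n) : {x : V | is_leaf cat x} :=
  exist _ (i, true) (caterpillar_leaf (i, true)).

Lemma caterpillar_label_bij : bijective caterpillar_label.
Proof.
exists (fun x => (val x).1) => // -[[i b] H]; apply: val_inj => /=.
by move: (H); rewrite caterpillar_leaf /= => ->.
Qed.

Definition caterpillar : rank_decomposition n :=
  RankDecomposition caterpillar_subcubic caterpillar_label_bij.

End Caterpillar.

Section RankWidthDef.
Variables (F : fieldType) (n : nat) (A : 'M[F]_n).

Definition rank_width_candidate (w : nat) : bool :=
  if (n <= 1)%N then w == 0%N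
  else `[< exists D : rank_decomposition n, decomposition_width A D = w >].

Lemma rank_width_candidate_ex : exists w, rank_width_candidate w.
Proof.
rewrite /rank_width_candidate; case: leqP => [_ | n1]; first by exists 0%N.
have D : rank_decomposition n.
  by case: n n1 => [//|[//|m]] _; exact: caterpillar.
by exists (decomposition_width A D); apply/asboolP; exists D.
Qed.

Definition rank_width : nat := ex_minn rank_width_candidate_ex.

End RankWidthDef.

(* Main.v *)
(** Write [lam X] for the rank of [M[X, ~X]] and consider the relation that [M]
    induces between the values of [x] and [y = M x] on [X] and the two families
    of [lam X] scalars exchanged with the complement of [X].  Deleting or
    contracting a vertex restricts this relation by [x v = 0] or [y v = 0], and
    two such relations with a bounded boundary are glued in finitely many ways.

    A decomposition tree that is lexicographically minimal for the numbers of
    ancestor-descendant pairs joined by labels at least [j] is linked: otherwise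
    uncrossing it along a small cut improves it.  Submodularity of rank gives a
    Tutte-type linking theorem: when [X] is linked to [Y], some deletions and
    contractions in [Y - X] turn the relation of [Y] into the relation of [X]
    followed by a bijection of the boundary.

    Well-quasi-ordering follows by descending induction on [s]: for trees whose
    nodes have label at least [s] over a well-quasi-ordered set of leaves, a
    minimal bad sequence of trees of label [s] is compared, by linkedness, with
    its subtrees of label [s], and what remains has labels larger than [s].
    Boundary bijections form a finite set and are removed by the pigeonhole
    principle.  At the root the boundary is empty, and restricting by [x = 0] and
    [y = 0] yields a principal submatrix of a Schur complement. *)

Require Import Defs.
From mathcomp Require Import all_boot all_order all_algebra.
From mathcomp Require Import boolp zify.

Set Implicit Arguments.
Unset Strict Implicit.
Unset Printing Implicit Defensive.

Import GRing.Theory.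

(** A Schur complement needs a nonsingular block, but the vertices to contract are found one at a
    time and their block may well be singular. Conditions [y v = 0] make sense in every case; a
    nonsingular block is extracted only at the root, from a row basis of the contracted block.

    Both kinds of matrix are treated as [M^T = eps *: M] with [eps * eps = 1]. This symmetry lets a
    single factor [frameP] describe both what a vertex set receives and what it sends, and it gives
    [lam (~: X) = lam X], on which uncrossing rests.

    Two orders are needed. Linking produces a minor only up to a twist of the boundary, whereas
    gluing the minors of two children requires that both boundaries be kept untouched. So [le_ex]
    serves for the comparison with subtrees and [le_id] for the passage from children to parents. *)

(** * Coordinate projectors and ranks of submatrices *)

Section CoordinateProjector.
Variables (F : fieldType) (n : nat).
Local Open Scope ring_scope.
Implicit Types (X Y : {set 'I_n}).

(** Submatrices are replaced by products with these projectors, so that set operations on the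
    indices never change the type of a matrix. *)
Definition pr X : 'M[F]_n := diag_mx (\row_i (i \in X)%:R).

Lemma mul_prE X p (A : 'M_(n, p)) i j :
  (pr X *m A) i j = if i \in X then A i j else 0.
Proof. by rewrite mul_diag_mx !mxE; case: (i \in X); rewrite ?mul1r ?mul0r. Qed.

Lemma prE X i j : pr X i j = ((i == j) && (i \in X))%:R.
Proof. by rewrite -[pr X]mulmx1 mul_prE mxE; case: (i \in X); rewrite ?andbT ?andbF. Qed.

Lemma tr_pr X : (pr X)^T = pr X.
Proof. exact: tr_diag_mx. Qed.

Lemma prI X Y : pr X *m pr Y = pr (X :&: Y).
Proof.
apply/matrixP=> i j; rewrite mul_prE !prE inE.
by case: (i \in X); rewrite ?andbF.
Qed.

Lemma pr_id X : pr X *m pr X = pr X.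
Proof. by rewrite prI setIid. Qed.

Lemma prT : pr setT = 1%:M.
Proof. by apply/matrixP=> i j; rewrite prE mxE inE andbT. Qed.

Lemma pr0 : pr set0 = 0.
Proof. by apply/matrixP=> i j; rewrite prE mxE inE andbF. Qed.

Lemma prU X Y : [disjoint X & Y] -> pr (X :|: Y) = pr X + pr Y.
Proof.
move=> dXY; apply/matrixP=> i j; rewrite [RHS]mxE !prE inE.
case: eqP => //= _; rewrite ?addr0 //.
have := disjointFr dXY (x := i); case: (i \in X) => /=; last by rewrite add0r.
by move=> -> //; rewrite addr0.
Qed.

Lemma prS X Y : X \subset Y -> pr X *m pr Y = pr X.
Proof. by move=> /setIidPl; rewrite prI => ->. Qed.

Lemma prSr X Y : X \subset Y -> pr Y *m pr X = pr X.
Proof. by move=> /setIidPr; rewrite prI => ->. Qed.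

Lemma prC X : pr X + pr (~: X) = 1%:M.
Proof. by rewrite -prU ?setUCr ?prT // -setI_eq0 setICr. Qed.

Definition selector X : 'M[F]_(#|X|, n) := \matrix_(a, i) (enum_val a == i)%:R.

Lemma submatrixE (M : 'M[F]_n) X Y :
  submatrix M X Y = selector X *m M *m (selector Y)^T.
Proof.
apply/matrixP=> a b; rewrite !mxE (bigD1 (enum_val b)) //= !mxE eqxx mulr1.
rewrite (bigD1 (enum_val a)) //= mxE eqxx mul1r.
rewrite !big1 ?addr0 // => i ni; rewrite !mxE.
  by rewrite eq_sym (negbTE ni) mulr0.
by rewrite eq_sym (negbTE ni) mul0r.
Qed.

Lemma selector_mul_tr X : selector X *m (selector X)^T = 1%:M.
Proof.
apply/matrixP=> a b; rewrite !mxE (bigD1 (enum_val a)) //= !mxE eqxx mul1r.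
rewrite big1 ?addr0 => [|i ni].
  by rewrite eq_sym (inj_eq enum_val_inj).
by rewrite !mxE eq_sym (negbTE ni) mul0r.
Qed.

Lemma selector_tr_mul X : (selector X)^T *m selector X = pr X.
Proof.
apply/matrixP=> i j; rewrite [LHS]mxE prE.
under eq_bigr => a _ do rewrite !mxE.
have [iX|iX] := boolP (i \in X); last first.
  rewrite big1 ?andbF // => a _; case: eqP => [E|]; last by rewrite mul0r.
  by move: iX; rewrite -E enum_valP.
rewrite (bigD1 (enum_rank_in iX i)) //= enum_rankK_in // eqxx mul1r andbT.
rewrite big1 ?addr0 // => a na; case: eqP => [E|]; last by rewrite mul0r.
by move: na; rewrite -(inj_eq enum_val_inj) enum_rankK_in // E eqxx.
Qed.

Lemma rank_submatrix (M : 'M[F]_n) X Y :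
  \rank (submatrix M X Y) = \rank (pr X *m M *m pr Y).
Proof.
apply/eqP; rewrite eqn_leq; apply/andP; split.
  have -> : submatrix M X Y =
      selector X *m (pr X *m M *m pr Y) *m (selector Y)^T.
    rewrite submatrixE -!selector_tr_mul !mulmxA selector_mul_tr mul1mx.
    by rewrite -!mulmxA selector_mul_tr mulmx1.
  exact: leq_trans (mxrankM_maxl _ _) (mxrankM_maxr _ _).
have -> : pr X *m M *m pr Y =
    (selector X)^T *m submatrix M X Y *m selector Y.
  by rewrite submatrixE -!selector_tr_mul !mulmxA.
exact: leq_trans (mxrankM_maxl _ _) (mxrankM_maxr _ _).
Qed.

Lemma rank_pr X : \rank (pr X) = #|X|.
Proof.
apply/eqP; rewrite eqn_leq; apply/andP; split.
  by rewrite -selector_tr_mul (leq_trans (mxrankM_maxr _ _)) // rank_leq_row.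
rewrite -[X in (X <= _)%N](mxrank1 F) -selector_mul_tr.
have -> : selector X = selector X *m pr X.
  by rewrite -selector_tr_mul mulmxA selector_mul_tr mul1mx.
exact: leq_trans (mxrankM_maxl _ _) (mxrankM_maxr _ _).
Qed.

End CoordinateProjector.

(** * Submodularity of cut-rank and the linking theorem *)

Section CutRank.
Variables (F : fieldType) (n : nat) (M : 'M[F]_n).
Local Open Scope ring_scope.
Implicit Types (A B W X Y Z S : {set 'I_n}).

Local Notation pr := (@pr F n).

Definition rho A B : nat := \rank (pr A *m M *m pr B).

(* [rho A B] is, up to a shift, the dimension of a space that is monotone in
   [A] and antitone in [B]; submodularity of dimension gives [rho_submod]. *)
Lemma rank_rho A B : \rank (pr A *m M + pr (~: B))%MS = (rho A B + #|~: B|)%N.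
Proof.
have E : (pr A *m M + pr (~: B) :=: pr A *m M *m pr B + pr (~: B))%MS.
  have H : pr A *m M = pr A *m M *m pr B + pr A *m M *m pr (~: B).
    by rewrite -mulmxDr prC mulmx1.
  apply/eqmxP; rewrite !addsmx_sub !addsmxSr !andbT; apply/andP; split.
    rewrite {1}H addmx_sub //; first exact: addsmxSl.
    exact: submx_trans (submxMl _ _) (addsmxSr _ _).
  have -> : pr A *m M *m pr B = pr A *m M - pr A *m M *m pr (~: B).
    by rewrite [X in X - _]H addrK.
  rewrite addmx_sub //; first exact: addsmxSl.
  rewrite eqmx_opp; exact: submx_trans (submxMl _ _) (addsmxSr _ _).
rewrite E mxrank_disjoint_sum ?rank_pr //.
apply/eqP; rewrite -submx0; apply/row_subP=> i.
have := row_sub i (pr A *m M *m pr B :&: pr (~: B))%MS.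
rewrite sub_capmx => /andP[]; move: (row i _) => u /submxP[C ->] /submxP[D E2].
have : C *m (pr A *m M *m pr B) *m pr B = D *m pr (~: B) *m pr B by rewrite E2.
rewrite -!mulmxA pr_id prI [_ :&: B]setIC setICr pr0 mulmx0 !mulmxA => ->.
exact: sub0mx.
Qed.

Lemma rho_submod A1 A2 B1 B2 :
  (rho (A1 :&: A2) (B1 :|: B2) + rho (A1 :|: A2) (B1 :&: B2)
     <= rho A1 B1 + rho A2 B2)%N.
Proof.
pose U A B := (pr A *m M + pr (~: B))%MS.
have subA A A' B B' : A \subset A' -> B' \subset B -> (U A B <= U A' B')%MS.
  move=> sA sB; apply: addsmxS.
    by rewrite -(prS F sA) -mulmxA submxMl.
  by rewrite -[pr (~: B)](@prS _ _ _ (~: B')) ?setCS // submxMl.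
have cap : (U (A1 :&: A2)%SET (B1 :|: B2)%SET <= U A1 B1 :&: U A2 B2)%MS.
  by rewrite sub_capmx !subA ?subsetIl ?subsetIr ?subsetUl ?subsetUr.
have sum : (U (A1 :|: A2)%SET (B1 :&: B2)%SET <= U A1 B1 + U A2 B2)%MS.
  have split X Y : (pr (X :|: Y)%SET <= pr X + pr Y)%MS.
    have -> : X :|: Y = X :|: (Y :\: X) by apply/setP=> i; rewrite !inE; case: (i \in X).
    rewrite prU; last by rewrite -setI_eq0 setDE setICA setICr setI0.
    apply: addmx_sub; first exact: addsmxSl.
    apply: submx_trans (addsmxSr _ _).
    by rewrite -[pr (Y :\: X)](@prS _ _ _ Y) ?subsetDl // submxMl.
  rewrite addsmx_sub; apply/andP; split.
    have := submxMr M (split A1 A2); rewrite addsmxMr => H.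
    by apply: submx_trans H _; apply: addsmxS; exact: addsmxSl.
  rewrite setCI; apply: submx_trans (split _ _) _.
  by apply: addsmxS; exact: addsmxSr.
have := leq_add (mxrankS cap) (mxrankS sum).
rewrite [X in (_ <= X)%N]addnC mxrank_sum_cap !rank_rho.
have := cardsUI (~: B1) (~: B2); rewrite -setCI -setCU; lia.
Qed.

Lemma rho_leqS A A' B B' :
  A \subset A' -> B \subset B' -> (rho A B <= rho A' B')%N.
Proof.
move=> sA sB; rewrite /rho.
have -> : pr A *m M *m pr B = pr A *m (pr A' *m M *m pr B') *m pr B.
  by rewrite !mulmxA prS // -!mulmxA prSr.
exact: leq_trans (mxrankM_maxl _ _) (mxrankM_maxr _ _).
Qed.

(** Induction on [W]: a vertex [v] is either dropped from [W] (deleted) or moved into [S]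
    (contracted). If each choice is blocked by some set, submodularity applied to the two blocking
    sets contradicts the hypothesis. *)
Lemma linking (kappa : nat) X Y W S :
    [disjoint W & S] ->
    (forall Z, Z \subset W ->
       kappa + #|S| <= rho (X :|: Z :|: S) (Y :|: (W :\: Z) :|: S))%N ->
  exists2 S' : {set 'I_n}, S' \subset W &
    (kappa + #|S :|: S'| <= rho (X :|: (S :|: S')) (Y :|: (S :|: S')))%N.
Proof.
have [m] := ubnP #|W|; elim: m W S => // m IH W S ltW dWS H.
have [W0|[v vW]] := set_0Vmem W.
  exists set0; first exact: sub0set.
  by have := H set0 (sub0set _); rewrite W0 setD0 !setU0.
have ltW' : (#|W :\ v| < m)%N by move: ltW; rewrite (cardsD1 v W) vW.
have dWS' : [disjoint W :\ v & S] by apply: disjointWl dWS; exact: subD1set.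
have vS : v \notin S by have := disjointFr dWS vW => ->.
have [Hdel|] := pselect (forall Z, Z \subset W :\ v ->
    kappa + #|S| <= rho (X :|: Z :|: S) (Y :|: (W :\ v :\: Z) :|: S))%N.
  have [S' sS' le] := IH _ _ ltW' dWS' Hdel.
  by exists S' => //; apply: subset_trans sS' (subD1set _ _).
move/existsNP=> [Z1 /not_implyP[sZ1 /negP]]; rewrite -ltnNge => lt1.
have [Hcon|] := pselect (forall Z, Z \subset W :\ v -> kappa + #|v |: S| <=
    rho (X :|: Z :|: (v |: S)) (Y :|: (W :\ v :\: Z) :|: (v |: S)))%N.
  have d : [disjoint W :\ v & v |: S].
    rewrite -setI_eq0; apply/eqP/setP=> i; rewrite !inE.
    by have := disjointFr dWS (x := i); case: (i \in W) (i == v) => [] [] //= ->.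
  have [S' sS' le] := IH _ _ ltW' d Hcon.
  exists (v |: S'); last by rewrite setUCA setUA.
  by rewrite subUset sub1set vW (subset_trans sS') // subD1set.
move/existsNP=> [Z2 /not_implyP[sZ2 /negP]]; rewrite -ltnNge => lt2.
have HI := H (Z1 :&: Z2) _; have HU := H (v |: (Z1 :|: Z2)) _.
have {}HI := HI (subset_trans (subsetIl _ _) (subset_trans sZ1 (subD1set _ _))).
have {}HU : (kappa + #|S| <= rho (X :|: (v |: (Z1 :|: Z2)) :|: S)
      (Y :|: W :\: (v |: (Z1 :|: Z2)) :|: S))%N.
  by apply: HU; rewrite !subUset sub1set vW !(subset_trans _ (subD1set W v)).
(* The right-hand side is at most [2 * (kappa + #|S|) - 1]: contracting [v] raises the second bound
   by one, but both failures are strict. On the left, [v] falls on the [Y] side for [Z1 :&: Z2] and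
   on the [X] side for the union, so the hypothesis applies to both terms. *)
have sub := rho_submod (X :|: Z1 :|: S) (X :|: Z2 :|: (v |: S))
  (Y :|: (W :\ v :\: Z1) :|: S) (Y :|: (W :\ v :\: Z2) :|: (v |: S)).
have vZ1 : v \notin Z1 by apply/negP=> /(subsetP sZ1); rewrite !inE eqxx.
have vZ2 : v \notin Z2 by apply/negP=> /(subsetP sZ2); rewrite !inE eqxx.
have E1 : (rho (X :|: (Z1 :&: Z2) :|: S) (Y :|: (W :\: (Z1 :&: Z2)) :|: S) <=
  rho ((X :|: Z1 :|: S) :&: (X :|: Z2 :|: (v |: S)))
   ((Y :|: (W :\ v :\: Z1) :|: S) :|: (Y :|: (W :\ v :\: Z2) :|: (v |: S))))%N.
  apply: rho_leqS; apply/subsetP=> i; rewrite !inE; case: (eqVneq i v) => [->|_].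
  - by rewrite (negbTE vZ1) (negbTE vS) /= !orbF => ->.
  - by case: (i \in X) (i \in Z1) (i \in Z2) (i \in S) => [] [] [] [].
  - by rewrite !orbT.
  - by case: (i \in Y) (i \in Z1) (i \in Z2) (i \in S) (i \in W) => [] [] [] [] [].
have E2 : (rho (X :|: (v |: (Z1 :|: Z2)) :|: S)
      (Y :|: W :\: (v |: (Z1 :|: Z2)) :|: S) <=
  rho ((X :|: Z1 :|: S) :|: (X :|: Z2 :|: (v |: S)))
   ((Y :|: (W :\ v :\: Z1) :|: S) :&: (Y :|: (W :\ v :\: Z2) :|: (v |: S))))%N.
  apply: rho_leqS; apply/subsetP=> i; rewrite !inE; case: (eqVneq i v) => [->|_].
  - by rewrite ?orbT.
  - by case: (i \in X) (i \in Z1) (i \in Z2) (i \in S) => [] [] [] [].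
  - by rewrite (negbTE vS) /= !orbF => ->.
  - by case: (i \in Y) (i \in Z1) (i \in Z2) (i \in S) (i \in W) => [] [] [] [] [].
move: lt2; rewrite cardsU1 vS; lia.
Qed.

Definition lam X : nat := rho X (~: X).

Lemma lam_submod X Y : (lam (X :&: Y) + lam (X :|: Y) <= lam X + lam Y)%N.
Proof. by rewrite /lam setCI setCU; exact: rho_submod. Qed.

Lemma lam0 : lam set0 = 0%N.
Proof. by rewrite /lam /rho pr0 !mul0mx mxrank0. Qed.

Lemma lamT : lam setT = 0%N.
Proof. by rewrite /lam /rho setCT pr0 mulmx0 mxrank0. Qed.

Lemma lamC (eps : F) X : eps * eps = 1 -> M^T = eps *: M -> lam (~: X) = lam X.
Proof.
move=> eps2 symM; rewrite /lam /rho setCK -mxrank_tr !trmx_mul !tr_pr symM.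
rewrite -scalemxAl -scalemxAr mulmxA mxrank_scale_nz //.
by apply: contra_eq_neq eps2 => ->; rewrite mul0r eq_sym oner_neq0.
Qed.

End CutRank.

(** * Well-quasi-orders and minimal bad sequences *)

Section WellQuasiOrder.
Variable T : Type.
Implicit Types (P : T -> Prop) (le : T -> T -> Prop) (f : nat -> T).

Definition wqo P le : Prop :=
  forall f, (forall i, P (f i)) -> exists i j, i < j /\ le (f i) (f j).

Definition infinitely_often (Q : nat -> Prop) : Prop :=
  forall N, exists2 i, N <= i & Q i.

Lemma infinitely_often_subseq Q : infinitely_often Q ->
  exists2 g : nat -> nat, (forall i j, i < j -> g i < g j) & forall i, Q (g i).
Proof.
move=> inf; have ex N : exists i, N <= i /\ Q i by have [i] := inf N; exists i.
have [next nextP] := choice ex.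
pose fix g n := if n is m.+1 then next (g m).+1 else next 0.
exists g => [|[|i]]; try by case: (nextP 0).
  move=> i j; elim: j => // j IH; rewrite ltnS leq_eqVlt => /orP[/eqP <-|/IH lt].
    by case: (nextP (g i).+1).
  by apply: ltn_trans lt _; case: (nextP (g j).+1).
by case: (nextP (g i).+1).
Qed.

(** Infinitely many terms without a larger later term would form a bad sequence. Beyond the last
    such term one can always step upwards. *)
Lemma wqo_subseq P le f : wqo P le -> (forall i, P (f i)) ->
  exists2 g : nat -> nat, (forall i j, i < j -> g i < g j) &
    forall i, le (f (g i)) (f (g i.+1)).
Proof.
move=> wqoP Pf.
pose stuck i := forall j, i < j -> ~ le (f i) (f j).
have [inf|] := pselect (infinitely_often stuck).
  have [g g_incr g_stuck] := infinitely_often_subseq inf.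
  have [i [j [ij leij]]] := wqoP (f \o g) (fun i => Pf _).
  by case: (g_stuck i (g j) (g_incr _ _ ij)).
move/existsNP=> [N stuckN].
have step (i : nat) : exists j, N <= i -> i < j /\ le (f i) (f j).
  have [leNi|ltiN] := leqP N i; last by exists 0.
  have /existsNP[j /not_implyP[ij /contrapT leij]] : ~ stuck i.
    by move=> si; apply: stuckN; exists i.
  by exists j.
have [next nextP] := choice step.
pose fix g n := if n is m.+1 then next (g m) else N.
have gN i : N <= g i.
  by elim: i => //= i IH; have [lt _] := nextP _ IH; exact: leq_trans IH (ltnW lt).
exists g => [i j|i]; last by case: (nextP _ (gN i)).
have lt1 k : g k < g k.+1 by case: (nextP _ (gN k)).
elim: j => // j IH; rewrite ltnS leq_eqVlt => /orP[/eqP <- //|/IH lt].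
exact: ltn_trans lt (lt1 j).
Qed.

Lemma wqo_chain P le f : (forall x y z, le x y -> le y z -> le x z) ->
    wqo P le -> (forall i, P (f i)) ->
  exists2 g : nat -> nat, (forall i j, i < j -> g i < g j) &
    forall i j, i < j -> le (f (g i)) (f (g j)).
Proof.
move=> tr wqoP Pf; have [g g_incr le1] := wqo_subseq wqoP Pf.
exists g => // i j; elim: j => // j IH.
rewrite ltnS leq_eqVlt => /orP[/eqP <- //|/IH lt].
exact: tr lt (le1 j).
Qed.

Lemma wqo_union P P' le : wqo P le -> wqo P' le -> wqo (fun x => P x \/ P' x) le.
Proof.
move=> wqoP wqoP' f Pf.
have [inf|] := pselect (infinitely_often (fun i => P (f i))).
  have [g g_incr gP] := infinitely_often_subseq inf.
  have [i [j [ij leij]]] := wqoP (f \o g) gP.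
  by exists (g i), (g j); split; [exact: g_incr|].
move/existsNP=> [N notP].
have P'f i : P' (f (N + i)).
  case: (Pf (N + i)) => // H; case: notP; exists (N + i) => //; exact: leq_addr.
have [i [j [ij leij]]] := wqoP' (fun i => f (N + i)) P'f.
by exists (N + i), (N + j); rewrite ltn_add2l.
Qed.

Lemma wqo_sub P P' le : (forall x, P x -> P' x) -> wqo P' le -> wqo P le.
Proof. by move=> PP' wqoP' f Pf; apply: wqoP' => i; exact: PP'. Qed.

Lemma pigeonhole (C : finType) (c : nat -> C) : exists i j, i < j /\ c i = c j.
Proof.
pose c' (i : 'I_#|C|.+1) := c i.
have /injectivePn[i [j ij E]] : ~~ injectiveb c'.
  apply/negP=> /injectiveP/leq_card; by rewrite card_ord ltnn.
have [lt|lt|/val_inj E'] := ltngtP i j; first by exists i, j.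
  by exists j, i.
by rewrite E' eqxx in ij.
Qed.

(* The first members [f 0], ..., [f (i - 1)] of a minimal bad sequence cannot
   be continued badly by an element smaller than [f i]. *)
Lemma minimal_bad_sequence P le (size : T -> nat) : ~ wqo P le ->
  exists f, [/\ forall i, P (f i), forall i j, i < j -> ~ le (f i) (f j) &
    forall i h, (forall j, P (h j)) ->
      (forall j, j < i -> h j = f j) -> (forall j l, j < l -> ~ le (h j) (h l)) ->
      size (f i) <= size (h i)].
Proof.
move=> /existsNP[f0 /not_implyP[Pf0 bad0]].
pose bad h := (forall i, P (h i)) /\ (forall i j, i < j -> ~ le (h i) (h j)).
have bad_f0 : bad f0.
  by split=> // i j ij leij; apply: bad0; exists i, j.
pose ok i (h h' : nat -> T) := bad h -> [/\ bad h', forall j, j < i -> h' j = h j &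
  forall g, bad g -> (forall j, j < i -> g j = h j) -> size (h' i) <= size (g i)].
have step (p : nat * (nat -> T)) : exists h', ok p.1 p.2 h'.
  case: p => i h; have [bh|nbh] := pselect (bad h); last by exists h => bh.
  pose Q m := `[< exists h', [/\ bad h', forall j, j < i -> h' j = h j & size (h' i) = m] >].
  have exQ : exists m, Q m.
    by exists (size (h i)); apply/asboolP; exists h.
  case: (ex_minnP exQ) => m /asboolP[h' [bh' eqh' sz]] minm.
  exists h' => _; split=> // g bg eqg; rewrite sz; apply: minm.
  by apply/asboolP; exists g.
have [next0 nextP] := choice step; pose next i h := next0 (i, h).
pose fix H n := if n is m.+1 then next m (H m) else f0.
have badH n : bad (H n).
  by elim: n => // n IH; case: (nextP (n, H n) IH).
have eqH m n : m <= n -> forall j, j < m -> H n j = H m j.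
  elim: n => [|n IH]; first by rewrite leqn0 => /eqP ->.
  rewrite leq_eqVlt => /orP[/eqP -> //|]; rewrite ltnS => mn j jm.
  rewrite /= -(IH mn j jm); case: (nextP (n, H n) (badH n)) => /= _ E _.
  by apply: E; exact: leq_trans jm mn.
(* The diagonal of the stages: stage [i.+1] makes position [i] minimal, and later stages leave it
   unchanged. *)
exists (fun i => H i.+1 i); split=> [i|i j ij|i h Ph eqh badh].
- by case: (badH i.+1).
- have -> : H i.+1 i = H j.+1 i by rewrite -(eqH i.+1 j.+1) // ltnW.
  by case: (badH j.+1) => _; apply.
- case: (nextP (i, H i) (badH i)) => /= _ _; apply=> // j ji.
  by rewrite eqh // -(eqH j.+1 i).
Qed.

End WellQuasiOrder.

(* The flag of a leaf tells whether its vertex is present; absent leaves let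
   [trim] preserve the shape of a tree. *)
Inductive dtree (V : Type) : Type :=
  | Leaf of V & bool
  | Node of dtree V & dtree V.

(** * Binary decomposition trees and their uncrossing *)

Section DecompositionTrees.
Variable V : finType.
Implicit Types (T U W : dtree V) (X Y Z : {set V}) (p : seq bool).

Fixpoint leaves T : {set V} :=
  match T with
  | Leaf v b => if b then [set v] else set0
  | Node l r => leaves l :|: leaves r
  end.

Fixpoint disjoint_leaves T : bool :=
  match T with
  | Leaf _ _ => true
  | Node l r =>
      [&& [disjoint leaves l & leaves r], disjoint_leaves l & disjoint_leaves r]
  end.

Fixpoint tree_size T : nat :=
  if T is Node l r then (tree_size l + tree_size r).+1 else 0.

Fixpoint nodes T : seq {set V} :=
  leaves T :: if T is Node l r then nodes l ++ nodes r else [::].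

Fixpoint trim Z T : dtree V :=
  match T with
  | Leaf v b => Leaf v (b && (v \in Z))
  | Node l r => Node (trim Z l) (trim Z r)
  end.

Lemma leaves_trim Z T : leaves (trim Z T) = leaves T :&: Z.
Proof.
elim: T => [v b|l IHl r IHr] /=; last by rewrite IHl IHr setIUl.
case: b => /=; last by rewrite set0I.
apply/setP=> i; case: ifP => vZ; rewrite !inE; case: eqP => // ->; by rewrite vZ.
Qed.

Lemma trim_id Z T : leaves T \subset Z -> trim Z T = T.
Proof.
elim: T => [v [] /=|l IHl r IHr] //=; first by rewrite sub1set => ->.
by rewrite subUset => /andP[/IHl -> /IHr ->].
Qed.

Lemma disjoint_leaves_trim Z T : disjoint_leaves T -> disjoint_leaves (trim Z T).
Proof.
elim: T => //= l IHl r IHr /and3P[d /IHl -> /IHr ->]; rewrite !leaves_trim !andbT.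
by apply: disjointWl (subsetIl _ _) (disjointWr (subsetIl _ _) d).
Qed.

Lemma nodes_sub T X : X \in nodes T -> X \subset leaves T.
Proof.
elim: T => [v b|l IHl r IHr] /=; rewrite in_cons => /orP[/eqP -> //|//].
rewrite mem_cat => /orP[/IHl s|/IHr s].
  exact: subset_trans s (subsetUl _ _).
exact: subset_trans s (subsetUr _ _).
Qed.

Lemma nodes_laminar T X Y : disjoint_leaves T -> X \in nodes T -> Y \in nodes T ->
  [|| X \subset Y, Y \subset X | [disjoint X & Y]].
Proof.
elim: T => [v b|l IHl r IHr] /=.
  by move=> _; rewrite !inE => /eqP -> /eqP ->; rewrite subxx.
case/and3P=> d wl wr; rewrite in_cons => /orP[/eqP ->|XT].
  by move=> /(@nodes_sub (Node l r)) /= ->; rewrite orbT.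
rewrite in_cons => /orP[/eqP ->|YT].
  have /nodes_sub /= -> // : X \in nodes (Node l r) by rewrite in_cons XT orbT.
move: XT YT; rewrite !mem_cat => /orP[Xl|Xr] /orP[Yl|Yr]; first exact: IHl.
- have -> : [disjoint X & Y].
    exact: disjointWl (nodes_sub Xl) (disjointWr (nodes_sub Yr) d).
  by rewrite !orbT.
- have -> : [disjoint X & Y].
    by rewrite disjoint_sym; exact: disjointWl (nodes_sub Yl) (disjointWr (nodes_sub Xr) d).
  by rewrite !orbT.
- exact: IHr.
Qed.

Lemma count_lt (I : eqType) (a b : pred I) (s : seq I) x :
    {in s, forall y, a y -> b y} -> x \in s -> b x -> ~~ a x ->
  count a s < count b s.
Proof.
move=> sub xs bx nax; have : subpred a (predU a b) by move=> y /= ->.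
elim: s sub xs => //= y s IH sub; rewrite in_cons => /orP[/eqP xy|xs] _.
  rewrite -xy bx (negbTE nax) add0n add1n ltnS.
  elim: s sub {IH} => //= z s IH sub; apply: leq_add.
    by have := sub z; rewrite !inE eqxx orbT; case: (a z) => // /(_ isT isT) ->.
  apply: IH => w ws; apply: sub; move: ws; rewrite !inE => /orP[->//|->].
  by rewrite !orbT.
rewrite -addnS; apply: leq_add.
  by have := sub y; rewrite !inE eqxx; case: (a y) => // /(_ isT isT) ->.
by apply: IH => // [w ws|w /= ->//]; apply: sub; rewrite in_cons ws orbT.
Qed.

Definition crosses Z X : bool := (X :&: Z != set0) && (X :\: Z != set0).

(** By laminarity no node becomes crossed: those inside [X] lie on one side of [Z'], those
    containing [X] were already crossed, and those disjoint from [X] see no change. The node [X]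
    itself stops being crossed. *)
Lemma crosses_lt T Z Z' X : disjoint_leaves T -> X \in nodes T -> crosses Z X ->
    Z' = Z :|: X \/ Z' = Z :\: X ->
  count (crosses Z') (nodes T) < count (crosses Z) (nodes T).
Proof.
move=> wT XT cX EZ'; apply: (count_lt _ XT cX) => [Y YT|]; last first.
  rewrite /crosses; case: EZ' => ->.
    have -> : X :\: (Z :|: X) = set0.
      by apply/setP=> i; rewrite !inE; case: (i \in X); rewrite ?orbT ?andbF.
    by rewrite eqxx andbF.
  have -> : X :&: (Z :\: X) = set0 by apply/setP=> i; rewrite !inE; case: (i \in X).
  by rewrite eqxx.
case/or3P: (nodes_laminar wT XT YT) => [sXY|sYX|dXY].
- case/andP: cX => /set0Pn[i]; rewrite inE => /andP[iX iZ] /set0Pn[j].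
  rewrite inE => /andP[jZ jX] _; apply/andP; split; apply/set0Pn.
    by exists i; rewrite inE (subsetP sXY) // iZ.
  by exists j; rewrite inE (subsetP sXY) // jZ.
- rewrite /crosses; case: EZ' => ->.
    have -> : Y :\: (Z :|: X) = set0.
      apply/setP=> i; rewrite !inE; case iY : (i \in Y); rewrite ?andbF //.
      by rewrite (subsetP sYX _ iY) orbT.
    by rewrite eqxx andbF.
  have -> : Y :&: (Z :\: X) = set0.
    apply/setP=> i; rewrite !inE; case iY : (i \in Y) => //.
    by rewrite (subsetP sYX _ iY).
  by rewrite eqxx.
- have xY i : i \in Y -> (i \in X) = false.
    by move=> iY; apply: disjointFl dXY iY.
  rewrite /crosses; case: EZ' => ->.
    have -> : Y :&: (Z :|: X) = Y :&: Z.
      by apply/setP=> i; rewrite !inE; case iY: (i \in Y) => //; rewrite xY // orbF.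
    have -> : Y :\: (Z :|: X) = Y :\: Z => //.
    by apply/setP=> i; rewrite !inE; case iY: (i \in Y); rewrite ?andbF // xY // orbF.
  have -> : Y :&: (Z :\: X) = Y :&: Z.
    by apply/setP=> i; rewrite !inE; case iY: (i \in Y) => //; rewrite xY.
  have -> : Y :\: (Z :\: X) = Y :\: Z => //.
  by apply/setP=> i; rewrite !inE; case iY: (i \in Y); rewrite ?andbF // xY.
Qed.

(** The uncrossing operation. It is used with [W] equal to [trim Z T], so that each node survives in
    two copies: its part inside [Z], within [W], and its part outside [Z], enlarged by [Z] when it
    lies on the path. *)
Fixpoint graft Z p T W : dtree V :=
  match p, T with
  | b :: p', Node l r =>
      if b then Node (trim (~: Z) l) (graft Z p' r W)
      else Node (graft Z p' l W) (trim (~: Z) r)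
  | _, _ => W
  end.

Variable lam : {set V} -> nat.
Local Notation lab T := (lam (leaves T)).

Fixpoint at_path s p T U : Prop :=
  match p, T with
  | [::], _ => T = U /\ s <= lab U
  | b :: p', Node l r => s <= lab T /\ at_path s p' (if b then r else l) U
  | _, _ => False
  end.

Lemma at_path_sub s p T U : at_path s p T U -> leaves U \subset leaves T.
Proof.
elim: p T => [|b p IH] [v c|l r] /= []; try by move=> <-.
move=> _ /IH; case: b => sub.
  exact: subset_trans sub (subsetUr _ _).
exact: subset_trans sub (subsetUl _ _).
Qed.

Lemma at_path_rcons s p T l r b : at_path s p T (Node l r) ->
  s <= lab (if b then r else l) -> at_path s (rcons p b) T (if b then r else l).
Proof.
elim: p T => [|c p IH] [v d|l' r'] //=; first by case.
  by case=> [[-> ->]] ? ?.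
by case=> -> /IH H /H.
Qed.

Lemma at_path_size s p T U : at_path s p T U -> tree_size U + size p <= tree_size T.
Proof.
elim: p T => [|b p IH] [v d|l' r'] //=; try by case=> <- _; rewrite addn0.
case=> _ /IH; case: b; lia.
Qed.

Lemma leaves_graft s p T U W Z : at_path s p T U -> leaves U \subset Z ->
  leaves W = Z -> leaves (graft Z p T W) = leaves T :|: Z.
Proof.
elim: p T => [|b p IH] [v c|l r] //=; try by move=> [<- _] /= /setUidPr -> ->.
case=> _; case: b => /IH{}IH sU lW /=; rewrite IH // leaves_trim;
  by apply/setP=> i; rewrite !inE; case: (i \in Z); rewrite ?orbT ?orbF ?andbT ?andbF.
Qed.

Lemma disjoint_leaves_graft s p T U W Z : at_path s p T U -> leaves U \subset Z ->
    leaves W = Z -> disjoint_leaves T -> disjoint_leaves W ->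
  disjoint_leaves (graft Z p T W).
Proof.
elim: p T => [|b p IH] [v c|l r] //=.
case=> _; case: b => H sU lW /and3P[d wl wr] wW /=.
  rewrite disjoint_leaves_trim // (IH r) // !andbT (leaves_graft H) // leaves_trim.
  rewrite -setI_eq0; apply/eqP/setP=> i; rewrite !inE.
  by have := disjointFr d (x := i); case: (i \in leaves l) => //= -> //; case: (i \in Z).
rewrite disjoint_leaves_trim // (IH l) // !andbT (leaves_graft H) // leaves_trim.
rewrite -setI_eq0; apply/eqP/setP=> i; rewrite !inE.
have := disjointFr d (x := i).
by case: (i \in leaves l) => /= [->//|_]; case: (i \in Z); rewrite ?andbF.
Qed.

(* [reg j T] counts the descendants joined to the root by labels at least [j], so
   [mu j T] counts the pairs joined in this way; uncrossing separates the two ends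
   of an unlinked pair and decreases [mu]. *)
Fixpoint reg j T : nat :=
  if lab T < j then 0 else if T is Node l r then (reg j l + reg j r).+1 else 1.

Fixpoint mu j T : nat := reg j T + if T is Node l r then mu j l + mu j r else 0.

Lemma mu_Node j l r : mu j (Node l r) = reg j (Node l r) + (mu j l + mu j r).
Proof. by []. Qed.

Definition reg_below j T : nat := if T is Node l r then (reg j l + reg j r).+1 else 1.

Lemma regE j T : reg j T = if j <= lab T then reg_below j T else 0.
Proof. by case: T => /= [v b|l r]; rewrite ltnNge; case: leqP. Qed.

Definition width_le k T : bool := all (fun X => lam X <= k) (nodes T).

Lemma width_leE k T : width_le k T =
  (lab T <= k) && (if T is Node l r then width_le k l && width_le k r else true).
Proof. by case: T => [v b|l r]; rewrite /width_le /= ?all_cat. Qed.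

(* A node with leaf set [X] of the tree to be uncrossed along [Z] gives a triple
   made of its label and of the labels of its two copies. *)
Definition off_triple Z X := (lam X, lam (X :&: Z), lam (X :\: Z)).
Definition on_triple Z X := (lam X, lam (X :&: Z), lam (X :|: Z)).
Definition off Z T := map (off_triple Z) (nodes T).

Fixpoint on Z p T : seq (nat * nat * nat) :=
  match p, T with
  | b :: p', Node l r => on_triple Z (leaves T) ::
      (if b then off Z l ++ on Z p' r else on Z p' l ++ off Z r)
  | _, _ => [::]
  end.

Definition lost j (t : nat * nat * nat) : bool :=
  [&& j <= t.1.1, t.1.2 < j & t.2 < j].

(** Under this condition the copies counted at level [j] inject into the nodes counted there, and
    [lost] marks the nodes that the injection misses. *)
Definition injective_at j (t : nat * nat * nat) : bool :=
  [&& (j <= t.1.2) ==> (j <= t.1.1), (j <= t.2) ==> (j <= t.1.1) &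
      ~~ ((j <= t.1.2) && (j <= t.2))].

(** At most one copy is counted, and its contribution is bounded by [i]. If the node is lost,
    [0 < i] pays for the extra unit. *)
Lemma copies_le j a b c i i1 i2 : injective_at j (a, b, c) -> i1 <= i -> i2 <= i ->
    0 < i ->
  (if j <= b then i1 else 0) + (if j <= c then i2 else 0) + lost j (a, b, c)
    <= (if j <= a then i else 0).
Proof. 
rewrite /injective_at /lost /=.
case: (leqP j a) => ?; case: (leqP j b) => ?; case: (leqP j c) => ? //=; lia.
 Qed.

Lemma reg_off j Z T : all (injective_at j) (off Z T) ->
  reg j (trim Z T) + reg j (trim (~: Z) T) + lost j (off_triple Z (leaves T))
    <= reg j T.
Proof.
elim: T => [v b|l IHl r IHr].
  rewrite /off [nodes _]/= [all _ _]/= andbT => inj.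
  by rewrite !regE !leaves_trim -setDE; apply: copies_le.
rewrite /off [nodes _]/= [all _ _]/= map_cat all_cat => /and3P[inj /IHl Il /IHr Ir].
rewrite !regE !leaves_trim -setDE; apply: copies_le => //=; lia.
Qed.

Lemma mu_off j Z T : all (injective_at j) (off Z T) ->
  mu j (trim Z T) + mu j (trim (~: Z) T) + count (lost j) (off Z T) <= mu j T.
Proof.
elim: T => [v b|l IHl r IHr] inj; have := reg_off inj.
  by rewrite /off [nodes _]/= [count _ _]/= /=; lia.
move: inj; rewrite /off [nodes _]/= [all _ _]/= [count _ _]/= map_cat all_cat count_cat.
move=> /and3P[inj /IHl Il /IHr Ir]; rewrite /off in Il Ir.
rewrite [trim Z _]/= [trim (~: Z) _]/= [leaves (Node l r)]/= !mu_Node; lia.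
Qed.

Lemma reg_graft s j p T U W Z : at_path s p T U -> leaves U \subset Z ->
    leaves W = Z -> lam Z < j -> all (injective_at j) (on Z p T) ->
  reg j (trim Z T) + reg j (graft Z p T W) + (if p is [::] then 0 else
    lost j (on_triple Z (leaves T)) : nat) <= reg j T.
Proof.
move=> + sU lW ltZ; have regW : reg j W = 0 by rewrite regE lW leqNgt ltZ.
elim: p T => [|b p IH] T.
  by case=> -> _ _; rewrite regW trim_id ?addn0.
case: T => // l r H; have := leaves_graft H sU lW; case: H => _.
case: b => H lg; rewrite [on _ _ _]/= [all _ _]/= all_cat.
  case/and3P=> inj /reg_off ioff /(IH _ H) ion.
  rewrite !regE leaves_trim lg; apply: copies_le => //=; lia.
case/and3P=> inj /(IH _ H) ion /reg_off ioff.
rewrite !regE leaves_trim lg; apply: copies_le => //=; lia.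
Qed.

(** [W] is kept independent of [T] because [T] shrinks along the path while the grafted tree does
    not. At the root [W] is [trim Z T], and its [mu] cancels on both sides. *)
Lemma mu_graft s j p T U W Z : at_path s p T U -> leaves U \subset Z ->
    leaves W = Z -> lam Z < j -> all (injective_at j) (on Z p T) ->
  mu j (trim Z T) + mu j (graft Z p T W) + count (lost j) (on Z p T)
    <= mu j T + mu j W.
Proof.
move=> + sU lW ltZ; elim: p T => [|b p IH] T.
  by case=> -> _ _; rewrite trim_id ?addn0.
case: T => // l r H inj; have := reg_graft H sU lW ltZ inj.
move: inj; case: H => _; case: b => H; rewrite [on _ _ _]/= [all _ _]/= [count _ _]/=.
  rewrite all_cat count_cat => /and3P[_ /mu_off ioff /(IH _ H) ion].
  rewrite [trim Z (Node l r)]/= [graft Z (_ :: _) _ _]/= [leaves (Node l r)]/= !mu_Node; lia.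
rewrite all_cat count_cat => /and3P[_ /(IH _ H) ion /mu_off ioff].
rewrite [trim Z (Node l r)]/= [graft Z (_ :: _) _ _]/= [leaves (Node l r)]/= !mu_Node; lia.
Qed.

(** The strict gain comes from the end of the path: [U] has label at least [s] and is counted, while
    [W], which replaces it, has label [lam Z < s] and counts for nothing. *)
Lemma reg_graft_lt s p T U W Z : at_path s p T U -> leaves U \subset Z ->
    leaves W = Z -> lam Z < s -> all (injective_at s) (on Z p T) ->
  reg s (graft Z p T W) < reg s T.
Proof.
move=> + sU lW ltZ; have regW : reg s W = 0 by rewrite regE lW leqNgt ltZ.
elim: p T => [|b p IH] T.
  by case=> -> le _; rewrite regW regE le; case: (U).
case: T => // l r [leT]; rewrite [reg s (Node l r)]regE leT /=.
case: b => H /andP[_]; rewrite all_cat => /andP[].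
  move=> /reg_off ioff /(IH _ H) ion; rewrite regE; case: ifP => //= _; lia.
move=> /(IH _ H) ion /reg_off ioff; rewrite regE; case: ifP => //= _; lia.
Qed.

(** The gain is in the term of the root: its copy inside [Z] has label below [s], and its other copy
    no longer reaches [U] through labels at least [s]. *)
Lemma mu_graft_lt s b p T U W Z : at_path s (b :: p) T U -> leaves U \subset Z ->
    leaves W = Z -> lam Z < s -> lam (leaves T :&: Z) < s ->
    all (injective_at s) (on Z (b :: p) T) ->
  mu s (trim Z T) + mu s (graft Z (b :: p) T W) < mu s T + mu s W.
Proof.
case: T => // l r H sU lW ltZ ltT inj.
have := reg_graft_lt H sU lW ltZ inj.
have : reg s (trim Z (Node l r)) = 0 by rewrite regE leaves_trim leqNgt ltT.
move: inj; case: H => _; case: b => H; rewrite [on _ _ _]/= [all _ _]/= all_cat.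
  move=> /and3P[_ /mu_off ioff ion]; have := mu_graft H sU lW ltZ ion.
  rewrite [trim Z (Node l r)]/= [graft Z (_ :: _) _ _]/= !mu_Node; lia.
move=> /and3P[_ ion /mu_off ioff]; have := mu_graft H sU lW ltZ ion.
rewrite [trim Z (Node l r)]/= [graft Z (_ :: _) _ _]/= !mu_Node; lia.
Qed.

Lemma on_spec s p T U Z t : disjoint_leaves T -> at_path s p T U -> t \in on Z p T ->
  exists2 X, X \in nodes T & ([disjoint X & leaves U] /\ t = off_triple Z X) \/
    (leaves U \subset X /\ t = on_triple Z X).
Proof.
elim: p T => [|b p IH] [v c|l r] //= /and3P[d wl wr] [leT H].
have sU := at_path_sub H.
rewrite in_cons => /orP[/eqP ->|].
  exists (leaves l :|: leaves r); first by rewrite mem_head.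
  right; split=> //; move: sU; case: (b) => sU.
    exact: subset_trans sU (subsetUr _ _).
  exact: subset_trans sU (subsetUl _ _).
case: b H sU => H sU; rewrite mem_cat => /orP[].
- case/mapP=> X Xl ->; exists X; first by rewrite in_cons mem_cat Xl orbT.
  by left; split=> //; apply: disjointWl (nodes_sub Xl) (disjointWr sU d).
- case/(IH _ wr H) => X Xr HX; exists X => //.
  by rewrite in_cons mem_cat Xr !orbT.
- case/(IH _ wl H) => X Xl HX; exists X => //.
  by rewrite in_cons mem_cat Xl !orbT.
case/mapP=> X Xr ->; exists X; first by rewrite in_cons mem_cat Xr !orbT.
left; split=> //; rewrite disjoint_sym.
exact: disjointWl sU (disjointWr (nodes_sub Xr) d).
Qed.

Lemma nodes_trim Z T : nodes (trim Z T) = [seq X :&: Z | X <- nodes T].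
Proof.
elim: T => [v b|l IHl r IHr]; first by congr cons; exact: (leaves_trim Z (Leaf v b)).
rewrite [nodes (Node l r)]/= [nodes _]/= IHl IHr map_cons map_cat; congr cons.
exact: (leaves_trim Z (Node l r)).
Qed.

Lemma width_trim k Z T : all (fun t => t.1.2 <= k) (off Z T) -> width_le k (trim Z T).
Proof. by rewrite /width_le /off nodes_trim !all_map. Qed.

Lemma width_trimC k Z T : all (fun t => t.2 <= k) (off Z T) ->
  width_le k (trim (~: Z) T).
Proof.
by rewrite /width_le nodes_trim /off !all_map; apply: sub_all => X /=; rewrite setDE.
Qed.

Lemma width_trim_on s k p T U Z : at_path s p T U -> leaves U \subset Z ->
    width_le k T -> all (fun t => t.1.2 <= k) (on Z p T) ->
  width_le k (trim Z T).
Proof.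
move=> + sU; elim: p T => [|b p IH] [v c|l r] //; try by case=> -> _; rewrite trim_id.
case=> _; case: b => H; rewrite [width_le k (Node l r)]width_leE => /and3P[_ wl wr];
  rewrite [on _ _ _]/= [all _ _]/= all_cat width_leE leaves_trim => /and3P[/= -> H1 H2].
  by rewrite (width_trim H1) (IH _ H).
by rewrite (width_trim H2) (IH _ H).
Qed.

Lemma width_graft s k p T U W Z : at_path s p T U -> leaves U \subset Z ->
    leaves W = Z -> width_le k W -> all (fun t => t.2 <= k) (on Z p T) ->
  width_le k (graft Z p T W).
Proof.
move=> + sU lW wW; elim: p T => [|b p IH] [v c|l r] //.
move=> H; have lg := leaves_graft H sU lW; case: H => _.
rewrite width_leE lg [on _ _ _]/=; case: b {lg} => H; rewrite [all _ _]/= all_cat /=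
  => /and3P[-> H1 H2] /=.
  by rewrite (width_trimC H1) (IH _ H).
by rewrite (width_trimC H2) (IH _ H).
Qed.

(** * Uncrossing along a minimal cut and existence of linked trees *)

Hypothesis lamC : forall X, lam (~: X) = lam X.
Hypothesis lam_submod : forall X Y, lam (X :&: Y) + lam (X :|: Y) <= lam X + lam Y.
Hypothesis lam0 : lam set0 = 0.

(** An off-path node crossed by the cut falls under the first alternative. One that is not crossed
    keeps one copy and has an empty second copy, of label 0. For a node on the path, both copies
    have label at least [z], and submodularity leaves only these cases. *)
Definition uncrossed z (t : nat * nat * nat) : bool :=
  [|| (t.1.2 < t.1.1) && (t.2 < t.1.1), (t.1.2 == t.1.1) && (t.2 <= z) |
      (t.2 == t.1.1) && (t.1.2 <= z)].

(** Injectivity at [j] could fail only if both copies reach [j > z]. Then both labels are strictly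
    below the label [a] of the node, so the node is lost at the level [a > j], which is excluded. *)
Lemma uncrossed_injective z j ts : all (uncrossed z) ts -> z < j ->
    (forall i, j < i -> count (lost i) ts = 0) ->
  all (injective_at j) ts.
Proof.
move=> /allP unc zj nolost; apply/allP=> -[[a b] c] tin; have := unc _ tin.
have : a <= j \/ ~~ lost a (a, b, c).
  have [le|lt] := leqP a j; [by left|right].
  have := nolost _ lt; apply: contra_eqN => lst.
  by rewrite -lt0n -has_count; apply/hasP; exists (a, b, c).
rewrite /uncrossed /lost /injective_at /= leqnn; lia.
Qed.

(* The witness is, among the cuts of minimal label separating [U] from the outside
   of [T], one that crosses as few nodes as possible. *)
Lemma exists_uncrossed_cut s p T U Z0 : disjoint_leaves T -> at_path s p T U ->
    leaves U \subset Z0 -> Z0 \subset leaves T -> lam Z0 < s ->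
  exists Z, [/\ leaves U \subset Z, Z \subset leaves T, lam Z < s &
    all (uncrossed (lam Z)) (on Z p T)].
Proof.
move=> wT atU sU0 s0T lt0.
pose N := (size (nodes T)).+1.
(* The crossing count is smaller than [N], so [w] encodes the lexicographic order on label and
   crossing count. *)
pose w Z := lam Z * N + count (crosses Z) (nodes T).
pose between Z := (leaves U \subset Z) && (Z \subset leaves T).
have btw0 : between Z0 by rewrite /between sU0.
case: (arg_minnP w btw0) => Z /andP[sUZ sZT] minZ.
have cntN X : count (crosses X) (nodes T) < N by rewrite ltnS count_size.
have minl Z' : leaves U \subset Z' -> Z' \subset leaves T -> lam Z <= lam Z'.
  move=> s1 s2; have := minZ Z'; rewrite /between s1 s2 => /(_ isT).
  have := cntN Z; have := cntN Z'; rewrite /w; nia.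
have minc Z' : leaves U \subset Z' -> Z' \subset leaves T ->
    count (crosses Z') (nodes T) < count (crosses Z) (nodes T) -> lam Z < lam Z'.
  move=> s1 s2; have := minZ Z'; rewrite /between s1 s2 => /(_ isT).
  have := cntN Z; have := cntN Z'; rewrite /w; nia.
exists Z; split=> //; first exact: leq_ltn_trans (minl _ sU0 s0T) lt0.
apply/allP=> t /(on_spec wT atU)[X XT [[dXU ->]|[sUX ->]]].
- have sX : X \subset leaves T by exact: nodes_sub.
  rewrite /uncrossed /=.
  have [E|XZ] := eqVneq (X :&: Z) set0.
    have -> : X :\: Z = X.
      by apply/setDidPl; rewrite -setI_eq0 E.
    by rewrite E lam0 eqxx !orbT.
  have [E|XDZ] := eqVneq (X :\: Z) set0.
    have -> : X :&: Z = X by apply/setIidPl; rewrite -setD_eq0 E.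
    by rewrite E lam0 eqxx !orbT.
  have cX : crosses Z X by rewrite /crosses XZ.
  (* Both [Z :|: X] and [Z :\: X] still separate and cross fewer nodes, so minimality makes their
     labels strictly larger than that of [Z]. Submodularity turns this surplus into a strict drop
     for the two copies of [X]. *)
  have l1 : lam Z < lam (Z :|: X).
    apply: minc.
    - exact: subset_trans sUZ (subsetUl _ _).
    - by rewrite subUset sZT.
    - by apply: (crosses_lt wT XT cX); left.
  have l2 : lam Z < lam (Z :\: X).
    apply: minc.
    - by rewrite subsetD sUZ disjoint_sym.
    - exact: subset_trans (subsetDl _ _) sZT.
    - by apply: (crosses_lt wT XT cX); right.
  have := lam_submod X Z; have := lam_submod X (~: Z).
  rewrite -setDE [X :|: ~: Z]setUC -(lamC (~: Z :|: X)) setCU setCK -setDE (lamC Z).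
  rewrite [X :|: Z]setUC => h1 h2; apply/orP; left.
  by apply/andP; split; [move: h2 l1|move: h1 l2]; clear; lia.
- have sX : X \subset leaves T by exact: nodes_sub.
  have l1 : lam Z <= lam (X :&: Z).
    by apply: minl; rewrite ?subsetI ?sUX // (subset_trans (subsetIl _ _) sX).
  have l2 : lam Z <= lam (X :|: Z).
    by apply: minl; rewrite ?subUset ?sX // (subset_trans sUX (subsetUl _ _)).
  rewrite /uncrossed /=; move: (lam_submod X Z) l1 l2.
  move: (lam X) (lam Z) (lam (X :&: Z)) (lam (X :|: Z)) => a b c d; clear; lia.
Qed.

(** The clause on [reg] is what lets an improvement of a subtree count as an improvement of the
    whole tree: the ancestors see the subtree only through [reg]. *)
Definition improves k T T' : Prop :=
  [/\ leaves T' = leaves T, disjoint_leaves T', width_le k T' &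
    exists2 j, j <= k & mu j T' < mu j T /\
      forall i, j <= i -> reg i T' <= reg i T /\ mu i T' <= mu i T].

Lemma improves_Node k b T T' U : disjoint_leaves (if b then Node U T else Node T U) ->
    width_le k (if b then Node U T else Node T U) -> improves k T T' ->
  improves k (if b then Node U T else Node T U) (if b then Node U T' else Node T' U).
Proof.
case: b; rewrite width_leE /= => /and3P[d w1 w2] /and3P[wd wd1 wd2];
  case=> lT' wT' wdT' [j jk [ltj lei]].
  split; [by rewrite /= lT'|by rewrite /= lT' d w1|by rewrite width_leE /= lT' wd wd1|].
  exists j => //; have [r1 m1] := lei j (leqnn _); split=> [|i ji].
    by rewrite /= lT'; move: ltj r1; case: (_ < j); lia.
  by have [r2 m2] := lei i ji; rewrite /= lT'; case: (_ < i); lia.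
split; [by rewrite /= lT'|by rewrite /= lT' d wT'|by rewrite width_leE /= lT' wd wdT'|].
exists j => //; have [r1 m1] := lei j (leqnn _); split=> [|i ji].
  by rewrite /= lT'; move: ltj r1; case: (_ < j); lia.
by have [r2 m2] := lei i ji; rewrite /= lT'; case: (_ < i); lia.
Qed.

Lemma exists_unimprovable k T : disjoint_leaves T -> width_le k T ->
  exists T', [/\ leaves T' = leaves T, disjoint_leaves T', width_le k T' &
    forall T'', ~ improves k T' T''].
Proof.
move=> wT wdT.
pose ok T' := [/\ leaves T' = leaves T, disjoint_leaves T' & width_le k T'].
suff [T' [oT' H]] : exists T', ok T' /\ forall T'' j, ok T'' -> 0 <= j -> j <= k ->
    (forall i, j <= i -> mu i T'' <= mu i T') -> ~ mu j T'' < mu j T'.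
  case: (oT') => lT' wT' wdT'; exists T'; split=> // T'' [lT'' w'' wd'' [j jk [lt le]]].
  have oT'' : ok T'' by split=> //; rewrite lT''.
  by apply: (H T'' j oT'' isT jk _ lt) => i /le[].
(* The lower bound on the levels is generalised, so that [mu] can be minimised at level [k] first
   and then downwards, each time among trees no worse at the levels above. *)
move: 0 => m; move Em : (k.+1 - m) => d.
elim: d m Em => [|d IH] m Em.
  exists T; split=> // T'' j _ mj jk; move: Em; lia.
have [|T1 [oT1 H1]] := IH m.+1; first lia.
pose Q x := `[< exists T', [/\ ok T', forall i, m < i -> mu i T' <= mu i T1 & mu m T' = x] >].
have exQ : exists x, Q x by exists (mu m T1); apply/asboolP; exists T1.
case: (ex_minnP exQ) => x /asboolP[T' [oT' le' Ex]] minx.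
exists T'; split=> // T'' j oT'' mj jk leT'' lt.
have [Ej|nj] := eqVneq j m.
  have /minx : Q (mu m T'').
    apply/asboolP; exists T''; split=> // i mi.
    by apply: leq_trans (le' _ mi); apply: leT''; rewrite Ej ltnW.
  by rewrite -Ex -Ej leqNgt lt.
have mj' : m < j by rewrite ltn_neqAle eq_sym nj.
apply: (H1 T'' j) => // [i ji|]; last by exact: leq_trans lt (le' _ mj').
by apply: leq_trans (leT'' _ ji) (le' _ _); exact: leq_trans ji.
Qed.

(** Restricted to descendants with the label of the root, reached through labels no smaller: these
    are the pairs compared in the minimal bad sequence argument. *)
Definition root_linked T : Prop := forall p U, at_path (lab T) p T U -> lab U = lab T ->
  forall Z, leaves U \subset Z -> Z \subset leaves T -> lab T <= lam Z.

Fixpoint linked T : Prop :=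
  root_linked T /\ if T is Node l r then linked l /\ linked r else True.

Lemma unimprovable_root_linked k T : disjoint_leaves T -> width_le k T ->
  (forall T', ~ improves k T T') -> root_linked T.
Proof.
move=> wT wdT unimp p U atU EU Z0 sU0 s0T; rewrite leqNgt; apply/negP=> lt0.
have [Z [sUZ sZT ltZ unc]] := exists_uncrossed_cut wT atU sU0 s0T lt0.
set s := lab T in atU EU lt0 ltZ.
case: p atU unc => [[ET _] _|b p atU unc].
  have E : Z = leaves T by apply/eqP; rewrite eqEsubset sZT ET sUZ.
  by move: ltZ; rewrite E ltnn.
have sk : s <= k by move: wdT; rewrite width_leE => /andP[].
have tk : all (fun t => t.1.1 <= k) (on Z (b :: p) T).
  apply/allP=> t /(on_spec wT atU)[X XT [[_ ->]|[_ ->]]] /=; exact: (allP wdT).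
have t2k : all (fun t => t.1.2 <= k) (on Z (b :: p) T).
  apply/allP=> -[[x y] z] tin; have := allP unc _ tin; have := allP tk _ tin.
  by rewrite /uncrossed /=; move: ltZ sk; clear; lia.
have t3k : all (fun t => t.2 <= k) (on Z (b :: p) T).
  apply/allP=> -[[x y] z] tin; have := allP unc _ tin; have := allP tk _ tin.
  by rewrite /uncrossed /=; move: ltZ sk; clear; lia.
have lW : leaves (trim Z T) = Z by rewrite leaves_trim; apply/setIidPr.
pose T' := graft Z (b :: p) T (trim Z T).
have lT' : leaves T' = leaves T.
  by rewrite (leaves_graft atU sUZ lW); apply/setUidPl.
have wT' : disjoint_leaves T'.
  by apply: (disjoint_leaves_graft atU) => //; exact: disjoint_leaves_trim.
have wdT' : width_le k T'.
  apply: (width_graft atU) => //; exact: (width_trim_on atU).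
have inj j : s <= j -> (forall i, j < i -> count (lost i) (on Z (b :: p) T) = 0) ->
    all (injective_at j) (on Z (b :: p) T).
  by move=> sj; apply: uncrossed_injective unc _; exact: leq_trans ltZ sj.
have le j : s <= j -> all (injective_at j) (on Z (b :: p) T) ->
    reg j T' <= reg j T /\ mu j T' + count (lost j) (on Z (b :: p) T) <= mu j T.
  move=> sj injj; have zj := leq_trans ltZ sj.
  have := reg_graft atU sUZ lW zj injj; have := mu_graft atU sUZ lW zj injj.
  by rewrite -/T' => h1 h2; split; [move: h2|move: h1]; clear; lia.
(* From level [k] downwards: with no loss above [i], all levels from [i] on are injective, so a loss
   at [i] would decrease [mu i] and improve the tree. *)
have nolost i : s < i -> count (lost i) (on Z (b :: p) T) = 0.
  have [m] := ubnP (k.+1 - i); elim: m i => // m IH i lti si.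
  have [ik|ki] := leqP i k; last first.
    apply/eqP; rewrite -leqn0 leqNgt -has_count; apply/hasPn=> t tin.
    by have /= le1 := allP tk _ tin; rewrite /lost leqNgt (leq_ltn_trans le1 ki).
  have above i' : i < i' -> count (lost i') (on Z (b :: p) T) = 0.
    by move=> ii'; apply: IH; move: lti ii' si ik; clear; lia.
  have injI j : i <= j -> all (injective_at j) (on Z (b :: p) T).
    move=> ij; apply: inj => [|i' ji']; first exact: leq_trans (ltnW si) ij.
    by apply: above; exact: leq_ltn_trans ij ji'.
  apply/eqP; rewrite -leqn0 leqNgt; apply/negP=> pos; apply: (unimp T'); split=> //.
  exists i => //; split=> [|i' ii'].
    by have [_] := le i (ltnW si) (injI i (leqnn _)); move: pos; clear; lia.
  by have [] := le i' (leq_trans (ltnW si) ii') (injI i' ii'); clear; lia.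
have injs j : s <= j -> all (injective_at j) (on Z (b :: p) T).
  by move=> sj; apply: inj => // i ji; apply: nolost; exact: leq_ltn_trans ji.
(* No level above [s] changes for the better, so the improvement is at [s] itself, where the root
   and [U] have been separated. *)
apply: (unimp T'); split=> //; exists s => //; split=> [|i si].
  have ltTZ : lam (leaves T :&: Z) < s by rewrite -leaves_trim lW.
  have := mu_graft_lt atU sUZ lW ltZ ltTZ (injs _ (leqnn _)).
  by rewrite -/T'; clear; lia.
by have [] := le i si (injs i si); clear; lia.
Qed.

Lemma unimprovable_linked k T : disjoint_leaves T -> width_le k T ->
  (forall T', ~ improves k T T') -> linked T.
Proof.
elim: T => [v b|l IHl r IHr] wT wdT unimp; split=> //.
- exact: unimprovable_root_linked unimp.
- exact: unimprovable_root_linked unimp.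
move: (wT) (wdT); rewrite width_leE /= => /and3P[d wl wr] /and3P[_ wdl wdr].
split; [apply: IHl|apply: IHr] => // T' imp.
  exact: unimp _ (@improves_Node k false l T' r wT wdT imp).
exact: unimp _ (@improves_Node k true r T' l wT wdT imp).
Qed.

Theorem exists_linked_tree k T : disjoint_leaves T -> width_le k T ->
  exists T', [/\ leaves T' = leaves T, disjoint_leaves T', width_le k T' & linked T'].
Proof.
move=> wT wdT; have [T' [lT' wT' wdT' unimp]] := exists_unimprovable wT wdT.
exists T'; split=> //; exact: unimprovable_linked unimp.
Qed.

End DecompositionTrees.

(** * Boundary relations, gluing and minors with boundary *)

Section BoundariedMatrices.
Variables (F : fieldType) (k : nat) (eps : F).
Local Open Scope ring_scope.
Hypothesis eps2 : eps * eps = 1.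

Local Notation boundary := ('cV[F]_k * 'cV[F]_k)%type.

Section Frame.
Variables (n : nat) (M : 'M[F]_n).
Implicit Types (X Y Z S : {set 'I_n}) (x y : 'cV[F]_n) (c b : boundary).
Local Notation pr := (@pr F n).

(* The definitions are locked since [mulmxA] would otherwise see through them. *)
Definition cut X : 'M[F]_n := locked (pr X *m M *m pr (~: X)).
(** The cut matrix factors as [frameP X *m frameQ X] through the first [lam X] of [k] coordinates.
    This projector onto them depends on the rank alone, so sets of equal label share it. *)
Definition frameE X : 'M[F]_k := pid_mx (\rank (cut X)).
Definition frameP X : 'M[F]_(n, k) :=
  locked (col_base (cut X) *m pid_mx (\rank (cut X))).
Definition frameQ X : 'M[F]_(k, n) :=
  locked (pid_mx (\rank (cut X)) *m row_base (cut X)).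

Lemma cutE X : cut X = pr X *m M *m pr (~: X).
Proof. by rewrite /cut -lock. Qed.

(* [x] and [y = M x] are seen from [X] only: [c.1] encodes what [X] receives from
   the outside and [c.2] what it sends there. *)
Definition boundary_rel X x y c : Prop :=
  [/\ pr X *m y = pr X *m M *m pr X *m x + frameP X *m c.1,
      c.2 = (frameP X)^T *m x & frameE X *m c.1 = c.1].

Lemma frameE_tr X : (frameE X)^T = frameE X.
Proof. by rewrite tr_pid_mx. Qed.

Section SmallCut.
Variable X : {set 'I_n}.
Hypothesis Xk : (lam M X <= k)%N.

Let rk : (\rank (cut X) <= k)%N. Proof. by rewrite cutE. Qed.

Lemma frameE_id : frameE X *m frameE X = frameE X.
Proof. by rewrite pid_mx_id. Qed.

Lemma framePE : frameP X *m frameE X = frameP X.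
Proof. by rewrite /frameP -lock -mulmxA pid_mx_id. Qed.

Lemma frameEQ : frameE X *m frameQ X = frameQ X.
Proof. by rewrite /frameQ -lock mulmxA pid_mx_id. Qed.

Lemma framePQ : frameP X *m frameQ X = cut X.
Proof.
rewrite /frameP /frameQ -!lock mulmxA -(mulmxA (col_base _)) pid_mx_id // pid_mx_1 mulmx1.
exact: mulmx_base.
Qed.

Lemma frameP_linv : exists P', P' *m frameP X = frameE X /\ frameE X *m P' = P'.
Proof.
have /row_fullP[B EB] := col_base_full (cut X).
exists (pid_mx (\rank (cut X)) *m B); split; last by rewrite mulmxA pid_mx_id.
by rewrite /frameP -lock mulmxA -(mulmxA _ B) EB mulmx1 pid_mx_id.
Qed.

Lemma frameQ_rinv : exists Q', frameQ X *m Q' = frameE X.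
Proof.
have /row_freeP[B EB] := row_base_free (cut X).
exists (B *m pid_mx (\rank (cut X))).
by rewrite /frameQ -lock mulmxA -(mulmxA _ _ B) EB mulmx1 pid_mx_id.
Qed.

Lemma frameP_cut : exists Q', frameP X = cut X *m Q'.
Proof.
have [Q' EQ'] := frameQ_rinv; exists Q'.
by rewrite -framePQ -mulmxA EQ' framePE.
Qed.

Lemma pr_frameP : pr X *m frameP X = frameP X.
Proof. by have [Q' ->] := frameP_cut; rewrite cutE !mulmxA pr_id. Qed.

Lemma frameP_factor p (B : 'M_(n, p)) P' : P' *m frameP X = frameE X ->
  (exists K, B = frameP X *m K) -> frameP X *m (P' *m B) = B.
Proof. by move=> EP' [K ->]; rewrite (mulmxA P') EP' mulmxA framePE. Qed.

End SmallCut.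

Lemma boundary_rel_ext X x y x' y' c : (lam M X <= k)%N ->
  pr X *m x = pr X *m x' -> pr X *m y = pr X *m y' ->
  boundary_rel X x y c -> boundary_rel X x' y' c.
Proof.
move=> Xk Ex Ey [E1 E2 E3]; split=> //; first by rewrite -Ey -mulmxA -Ex mulmxA.
by rewrite E2 -(pr_frameP Xk) trmx_mul tr_pr -!mulmxA Ex.
Qed.

Lemma pr_mulP X p (A B : 'M[F]_(n, p)) :
  (forall i, i \in X -> forall j, A i j = B i j) -> pr X *m A = pr X *m B.
Proof. by move=> E; apply/matrixP=> i j; rewrite !mul_prE; case: ifP => // /E. Qed.

Hypothesis symM : M^T = eps *: M.

Lemma tr_pr_mul X Y : (pr X *m M *m pr Y)^T = eps *: (pr Y *m M *m pr X).
Proof. by rewrite !trmx_mul !tr_pr symM -scalemxAl -scalemxAr mulmxA. Qed.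

Lemma scale_epsK p q (A : 'M[F]_(p, q)) : eps *: (eps *: A) = A.
Proof. by rewrite scalerA eps2 scale1r. Qed.

Lemma cut_sub X Y : Y \subset ~: X -> pr X *m M *m pr Y = cut X *m pr Y.
Proof. by move=> s; rewrite cutE -!mulmxA prSr. Qed.

Definition gluing : Type := ('M[F]_k * 'M[F]_k * ('M[F]_k * 'M[F]_k))%type.

(** [C] encodes the block between the two parts, with [eps *: C^T] for the opposite direction; [D1]
    and [D2] express the outer boundary in the frames of the parts, and [E] is the outer
    projector. *)
Definition glue_rel (o : gluing) (c c' c'' : boundary) : Prop :=
  let C := o.1.1 in let E := o.1.2 in let D1 := o.2.1 in let D2 := o.2.2 in
  [/\ c'.1 = C *m c''.2 + D1 *m c.1, c''.1 = eps *: (C^T *m c'.2) + D2 *m c.1,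
      c.2 = D1^T *m c'.2 + D2^T *m c''.2 & E *m c.1 = c.1].

(** The block between [X1] and [X2] belongs to the cuts of both, so it factors through both frames,
    which gives [C]. The outside of the union is outside each part, so [frameP] of the union,
    restricted to a part, factors through the frame of that part, which gives [D1] and [D2]. *)
Lemma exists_gluing X1 X2 : [disjoint X1 & X2] -> (lam M X1 <= k)%N ->
    (lam M X2 <= k)%N -> (lam M (X1 :|: X2) <= k)%N ->
  exists o, forall x y c, boundary_rel (X1 :|: X2) x y c <->
    exists c' c'', [/\ boundary_rel X1 x y c', boundary_rel X2 x y c'' &
      glue_rel o c c' c''].
Proof.
move=> d12 k1 k2 k12; set X := X1 :|: X2 in k12 *.
have s21 : X2 \subset ~: X1 by rewrite -disjoints_subset disjoint_sym.
have s12 : X1 \subset ~: X2 by rewrite -disjoints_subset.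
have [P1' [EP1 EP1']] := frameP_linv k1; have [P2' [EP2 EP2']] := frameP_linv k2.
have [B EB] : exists B, B = pr X1 *m M *m pr X2 by exists (pr X1 *m M *m pr X2).
have EBt : eps *: B^T = pr X2 *m M *m pr X1 by rewrite EB tr_pr_mul scale_epsK.
have B1 : frameP X1 *m (P1' *m B) = B.
  apply: (frameP_factor k1) => //; exists (frameQ X1 *m pr X2).
  by rewrite mulmxA framePQ // -cut_sub.
have B2 : frameP X2 *m (P2' *m B^T) = B^T.
  apply: (frameP_factor k2) => //; exists (eps *: (frameQ X2 *m pr X1)).
  by rewrite EB tr_pr_mul -scalemxAr mulmxA framePQ // -cut_sub.
have s1 : X1 \subset X by exact: subsetUl.
have s2 : X2 \subset X by exact: subsetUr.
have restr Y (P' : 'M_(k, n)) : (lam M Y <= k)%N -> Y \subset X ->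
    P' *m frameP Y = frameE Y -> frameE Y *m P' = P' ->
    exists2 D, frameP Y *m D = pr Y *m frameP X & frameE Y *m D = D.
  move=> Yk sY EP' EP''; exists (P' *m (pr Y *m frameP X)); last by rewrite mulmxA EP''.
  apply: (frameP_factor Yk) => //.
  have [Q' ->] := frameP_cut k12; exists (frameQ Y *m pr (~: X) *m Q').
  by rewrite !mulmxA framePQ // -cut_sub ?setCS // cutE !mulmxA prS.
have [D1 R1 ED1] := restr _ _ k1 s1 EP1 EP1'.
have [D2 R2 ED2] := restr _ _ k2 s2 EP2 EP2'.
have [C [EC EC1 EC2]] : exists C, [/\ frameP X1 *m C *m (frameP X2)^T = B,
    frameE X1 *m C = C & frameE X2 *m C^T = C^T].
  exists (P1' *m B *m P2'^T); split.
  - rewrite mulmxA B1; apply: trmx_inj.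
    by rewrite !trmx_mul !trmxK.
  - by rewrite !mulmxA EP1'.
  - by rewrite !trmx_mul trmxK !mulmxA EP2'.
have EC' : eps *: (frameP X2 *m C^T *m (frameP X1)^T) = eps *: B^T.
  by rewrite -EC !trmx_mul trmxK mulmxA.
have prX : pr X = pr X1 + pr X2 by rewrite prU.
have decP : frameP X = frameP X1 *m D1 + frameP X2 *m D2.
  by rewrite R1 R2 -mulmxDl -prX pr_frameP.
have MX1 : pr X1 *m M *m pr X = pr X1 *m M *m pr X1 + B by rewrite prX mulmxDr EB.
have MX2 : pr X2 *m M *m pr X = eps *: B^T + pr X2 *m M *m pr X2.
  by rewrite prX mulmxDr EBt.
clear EB EBt restr.
exists (C, frameE X, (D1, D2)) => x y c; split.
- move=> [E1 E2 E3].
  pose c1 := (C *m ((frameP X2)^T *m x) + D1 *m c.1, (frameP X1)^T *m x).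
  pose c2 := (eps *: (C^T *m ((frameP X1)^T *m x)) + D2 *m c.1, (frameP X2)^T *m x).
  exists c1, c2; split.
  + split=> //=; last by rewrite mulmxDr !mulmxA EC1 ED1.
    have -> : pr X1 *m y = pr X1 *m (pr X *m y) by rewrite mulmxA prS.
    rewrite E1 !mulmxDr !mulmxA prS // MX1 mulmxDl -addrA; congr (_ + (_ + _)).
      by rewrite EC.
    by rewrite R1.
  + split=> //=; last by rewrite mulmxDr -scalemxAr !mulmxA EC2 ED2.
    have -> : pr X2 *m y = pr X2 *m (pr X *m y) by rewrite mulmxA prS.
    rewrite E1 !mulmxDr -scalemxAr !mulmxA prS // MX2 mulmxDl.
    rewrite [X in X + _ = _]addrC -addrA; congr (_ + (_ + _)); last by rewrite R2.
    by rewrite -EC' !scalemxAl.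
  + split=> //=.
    by rewrite E2 decP linearD /= !trmx_mul mulmxDl !mulmxA.
- move=> [[c11 c12] [[c21 c22] [[/= E1 E2 E3] [/= F1 F2 F3] [/= G1 G2 G3 G4]]]].
  split=> //.
  + rewrite {1}prX mulmxDl E1 F1 G1 G2 E2 F2 !mulmxDr -scalemxAr !mulmxA EC.
    have -> : pr X *m M *m pr X = pr X1 *m M *m pr X1 + B + (eps *: B^T + pr X2 *m M *m pr X2).
      by rewrite {1}prX !mulmxDl MX1 MX2.
    rewrite decP !mulmxDl -EC' -!scalemxAl.
    rewrite [X in X + _ = _]addrA [X in _ + X = _]addrA.
    by rewrite [X in _ + (X + _) = _]addrC addrACA.
  + by rewrite G3 E2 F2 decP linearD /= !trmx_mul mulmxDl !mulmxA.
Qed.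

End Frame.

Section Minor.
Variables (n n' : nat) (M : 'M[F]_n) (M' : 'M[F]_n').

(** [S] holds the contracted vertices; the other vertices of [X'] outside the image are deleted. An
    equivalence of relations, rather than an equation between matrices, makes sense even if the
    contracted block is singular. *)
Definition bminor (X : {set 'I_n}) (X' : {set 'I_n'}) (phi : boundary -> boundary) :=
  exists iota : 'I_n -> 'I_n', exists S : {set 'I_n'},
  [/\ {in X &, injective iota}, iota @: X \subset X' &
    forall x y c, boundary_rel M X x y c <-> exists x' y',
      [/\ boundary_rel M' X' x' y' (phi c),
          forall i, i \in X -> x' (iota i) 0 = x i 0 /\ y' (iota i) 0 = y i 0 &
          forall j, j \in X' :\: iota @: X ->
            if j \in S then y' j 0 = 0 else x' j 0 = 0]].

End Minor.

Lemma bminor_trans n n' n'' (M : 'M[F]_n) (M' : 'M[F]_n') (M'' : 'M[F]_n'')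
    X X' X'' phi phi' :
    bminor M M' X X' phi -> bminor M' M'' X' X'' phi' ->
  bminor M M'' X X'' (phi' \o phi).
Proof.
move=> [f [S [injf sf relf]]] [g [S' [injg sg relg]]].
have fX' i : i \in X -> f i \in X'.
  by move=> iX; apply: (subsetP sf); exact: imset_f.
(* The intersection with [X'] is there because [g] is injective only on [X']. *)
exists (g \o f), [set j | if j \in g @: X' then j \in g @: (S :&: X') else j \in S'].
have gfX : (g \o f) @: X = g @: (f @: X) by rewrite imset_comp.
have sgf : (g \o f) @: X \subset g @: X' by rewrite gfX; exact: imsetS.
split=> [i j iX jX /= /(injg _ _ (fX' _ iX) (fX' _ jX))||x y c]; first exact: injf.
  exact: subset_trans sgf sg.
split.
  case/relf => x' [y' [/relg[x'' [y'' [rel'' keep'' out'']]] keep' out']].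
  exists x'', y''; split=> // [i iX|j].
    by have [-> ->] := keep'' _ (fX' _ iX); exact: keep'.
  rewrite inE => /andP[njX jX'']; rewrite inE.
  have [/imsetP[i iX' Ej]|njX'] := boolP (j \in g @: X'); last first.
    by apply: out''; rewrite inE njX'.
  have nifX : i \notin f @: X.
    by apply: contra njX => ifX; rewrite gfX Ej; exact: imset_f.
  have [Ex Ey] := keep'' _ iX'; have := out' i; rewrite inE nifX => /(_ iX').
  rewrite Ej Ex Ey; case: ifPn => iS.
    by rewrite ifT //; apply: imset_f; rewrite inE iS.
  rewrite ifF //; apply/negbTE; apply/imsetP=> -[i' /setIP[i'S i'X] /injg E].
  by rewrite E ?i'S in iS.
case=> x'' [y'' [rel'' keep'' out'']]; apply/relf.
pose x' := \col_i x'' (g i) 0; pose y' := \col_i y'' (g i) 0.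
exists x', y'; split.
- apply/relg; exists x'', y''; split=> // [i _|j]; first by rewrite !mxE.
  rewrite inE => /andP[njX' jX'']; have := out'' j.
  rewrite !inE (negbTE njX') jX'' andbT; apply.
  by apply: contra njX'; exact: subsetP sgf _.
- by move=> i iX; rewrite !mxE; exact: keep''.
- move=> i; rewrite inE => /andP[nifX iX'].
  have gi : g i \in X'' by apply: (subsetP sg); exact: imset_f.
  have ngi : g i \notin (g \o f) @: X.
    rewrite gfX; apply: contra nifX => /imsetP[i' i'X /injg -> //].
    exact: (subsetP sf).
  have := out'' (g i); rewrite !inE ngi gi imset_f // => /(_ isT); rewrite !mxE.
  case: ifPn => iS.
    case/imsetP: iS => i' /setIP[i'S i'X] /injg -> //; by rewrite i'S.
  rewrite ifF //; apply/negbTE; apply: contra iS => iS.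
  by apply: imset_f; rewrite inE iS.
Qed.

(** Since both twists are the identity, the same pair of inner boundaries serves in [M] and in [M'],
    and the common gluing [o] relates it to the same outer boundary. *)
Lemma bminor_glue n n' (M : 'M[F]_n) (M' : 'M[F]_n')
    (X1 X2 : {set 'I_n}) (X1' X2' : {set 'I_n'}) (o : gluing) :
    [disjoint X1 & X2] -> [disjoint X1' & X2'] ->
    (lam M' X1' <= k)%N -> (lam M' X2' <= k)%N ->
    (forall x y c, boundary_rel M (X1 :|: X2) x y c <->
       exists c' c'', [/\ boundary_rel M X1 x y c', boundary_rel M X2 x y c'' &
         glue_rel o c c' c'']) ->
    (forall x y c, boundary_rel M' (X1' :|: X2') x y c <->
       exists c' c'', [/\ boundary_rel M' X1' x y c', boundary_rel M' X2' x y c'' &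
         glue_rel o c c' c'']) ->
    bminor M M' X1 X1' id -> bminor M M' X2 X2' id ->
  bminor M M' (X1 :|: X2) (X1' :|: X2') id.
Proof.
move=> d d' k1 k2 glue glue' [f1 [S1 [inj1 sub1 rel1]]] [f2 [S2 [inj2 sub2 rel2]]].
have in1 i : i \in X1 -> f1 i \in X1'.
  by move=> iX; apply: (subsetP sub1); exact: imset_f.
have in2 i : i \in X2 -> f2 i \in X2'.
  by move=> iX; apply: (subsetP sub2); exact: imset_f.
have no2 i : i \in X2 -> (i \in X1) = false by move=> iX; exact: disjointFl d iX.
have no2' i : i \in X2' -> (i \in X1') = false by move=> iX; exact: disjointFl d' iX.
pose f i := if i \in X1 then f1 i else f2 i.
have fX1 i : i \in X1 -> f i = f1 i by rewrite /f => ->.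
have fX2 i : i \in X2 -> f i = f2 i by move=> iX; rewrite /f no2.
have imf : f @: (X1 :|: X2) = f1 @: X1 :|: f2 @: X2.
  by rewrite imsetU (eq_in_imset fX1) (eq_in_imset fX2).
exists f, [set j | if j \in X1' then j \in S1 else j \in S2]; split.
- move=> i j /setUP[iX|iX] /setUP[jX|jX];
  rewrite ?(fX1 _ iX) ?(fX2 _ iX) ?(fX1 _ jX) ?(fX2 _ jX).
  + exact: inj1.
  + by move=> E; have := no2' _ (in2 _ jX); rewrite -E in1.
  + by move=> E; have := no2' _ (in2 _ iX); rewrite E in1.
  + exact: inj2.
- by rewrite imf; exact: setUSS.
move=> x y c; split.
  case/glue => c' [c'' [/rel1[x1 [y1 [r1 keep1 out1]]] /rel2[x2 [y2 [r2 keep2 out2]]] g]].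
  pose x' := \col_j (if j \in X1' then x1 j 0 else x2 j 0).
  pose y' := \col_j (if j \in X1' then y1 j 0 else y2 j 0).
  exists x', y'; split.
  - apply/glue'; exists c', c''; split=> //.
      apply: boundary_rel_ext r1 => //; apply: pr_mulP => i iX j;
      by rewrite !mxE iX (ord1 j).
    apply: boundary_rel_ext r2 => //; apply: pr_mulP => i iX j;
    by rewrite !mxE no2' // (ord1 j).
  - move=> i /setUP[iX|iX]; rewrite !mxE.
      by rewrite fX1 // in1 //; exact: keep1.
    by rewrite fX2 // no2' ?in2 //; exact: keep2.
  - move=> j; rewrite imf !inE negb_or -andbA => /and3P[n1 n2 /orP[jX|jX]].
      by rewrite !mxE jX; apply: out1; rewrite inE n1.
    by rewrite !mxE no2' //; apply: out2; rewrite inE n2.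
case=> x' [y' [/glue'[c' [c'' [r1 r2 g]]] keep out]]; apply/glue.
exists c', c''; split=> //.
  apply/rel1; exists x', y'; split=> // [i iX|j].
    by rewrite -fX1 //; apply: keep; rewrite inE iX.
  rewrite inE => /andP[n1 jX]; have := out j; rewrite imf !inE jX (negbTE n1) /=.
  rewrite andbT; apply; apply: contraL jX => /(subsetP sub2) /no2' ->.
  by [].
apply/rel2; exists x', y'; split=> // [i iX|j].
  by rewrite -fX2 //; apply: keep; rewrite inE iX orbT.
rewrite inE => /andP[n1 jX]; have := out j; rewrite imf !inE jX (negbTE n1) no2' //.
rewrite orbF orbT andbT; apply; apply/negP=> /(subsetP sub1).
by rewrite no2'.
Qed.

(** The row space of [Phi] lies in that of [E] and has no smaller dimension, so the two coincide. *)
Lemma corner_inverse m (Phi E : 'M[F]_m) : Phi *m E = Phi ->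
  (\rank E <= \rank Phi)%N -> exists Psi, E = Psi *m Phi.
Proof.
move=> EPhi le; have sub : (Phi <= E)%MS by rewrite -EPhi submxMl.
have [le' eq] := mxrank_leqif_sup sub.
by apply/submxP; rewrite -eq eqn_leq le' le.
Qed.

(** * From linked sets to a minor with twisted boundary *)

Section Linking.
Variables (n : nat) (M : 'M[F]_n) (X Y : {set 'I_n}).
Hypothesis symM : M^T = eps *: M.
Hypothesis sXY : X \subset Y.
Hypothesis lamXY : lam M X = lam M Y.
Hypothesis Yk : (lam M Y <= k)%N.
Hypothesis linkXY : forall Z : {set 'I_n},
  X \subset Z -> Z \subset Y -> (lam M Y <= lam M Z)%N.

Local Notation pr := (@pr F n).
Local Notation P := (frameP M X).
Local Notation Q := (frameQ M X).
Local Notation P' := (frameP M Y).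
Local Notation Q' := (frameQ M Y).
Local Notation E := (frameE M Y).

Let Xk : (lam M X <= k)%N. Proof. by rewrite lamXY. Qed.

Let EX : frameE M X = E.
Proof.
have rk Z : \rank (cut M Z) = lam M Z by rewrite cutE.
by rewrite /frameE !rk lamXY.
Qed.

(** The linking theorem between [X] and [~: Y]: the column set attached to [Z] is the complement of
    [X :|: Z], so its hypothesis becomes [linkXY]. *)
Lemma linking_set : exists2 S : {set 'I_n}, S \subset Y :\: X &
  (lam M Y + #|S| <= rho M (X :|: S) (~: Y :|: S))%N.
Proof.
have [|Z sZ|S sS] := @linking F n M (lam M Y) X (~: Y) (Y :\: X) set0.
- by rewrite -setI_eq0 setI0.
- rewrite cards0 addn0 !setU0.
  have -> : ~: Y :|: (Y :\: X) :\: Z = ~: (X :|: Z).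
    apply/setP=> i; have /implyP := subsetP sZ i; have /implyP := subsetP sXY i.
    by rewrite !inE; case: (i \in X) (i \in Y) (i \in Z) => [] [] [].
  apply: linkXY; first exact: subsetUl.
  by rewrite subUset sXY (subset_trans sZ) // subsetDl.
- by rewrite !set0U; exists S.
Qed.

(* What passes between the two boundaries when [S] is contracted and the rest of
   [Y :\: X] is deleted; [u] is the value of [x] on [S]. *)
Definition transfer S D (c b : boundary) : Prop :=
  exists u : 'cV[F]_n, [/\ pr S *m u = u, E *m b.1 = b.1, c.1 = D *m b.1 + Q *m u,
    eps *: (pr S *m Q^T *m c.2) + pr S *m M *m u + pr S *m P' *m b.1 = 0 &
    b.2 = D^T *m c.2 + P'^T *m u].

(** The rank bound for [S] makes the linear system in [b.1] and [u] invertible on the relevant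
    coordinates. Solving it gives totality; solving its transpose, which governs [c.2] and [u] by
    the symmetry of [M], gives injectivity. *)
Lemma exists_transfer : exists (S : {set 'I_n}) D,
  [/\ S \subset Y :\: X, pr X *m P' = P *m D, E *m D = D, D *m E = D &
   (forall c, E *m c.1 = c.1 -> E *m c.2 = c.2 -> exists b, transfer S D c b) /\
   (forall c d b, E *m c.2 = c.2 -> E *m d.2 = d.2 ->
      transfer S D c b -> transfer S D d b -> c = d)].
Proof.
have [S sS rkS] := linking_set; exists S.
have sSX : S \subset ~: X by apply: subset_trans sS _; rewrite setDE subsetIr.
have sSY : S \subset Y by apply: subset_trans sS (subsetDl _ _).
have [P1 [EP1 EP1']] := frameP_linv Xk; rewrite EX in EP1 EP1'.
have P'E : P' *m E = P' by exact: framePE.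
have EQ : E *m Q = Q by rewrite -EX frameEQ.
have [D [ED1 ED2 ED3]] : exists D, [/\ pr X *m P' = P *m D, E *m D = D & D *m E = D].
  exists (P1 *m (pr X *m P')); split.
  - apply/esym/(frameP_factor Xk); first by rewrite EX.
    have [R ->] := frameP_cut Yk; exists (Q *m pr (~: Y) *m R).
    by rewrite !mulmxA framePQ // -cut_sub ?setCS // cutE !mulmxA prS.
  - by rewrite mulmxA EP1'.
  - by rewrite -!mulmxA P'E.
exists D.
(* [Phi] is the coefficient matrix of the system and [EE] projects onto its relevant coordinates. A
   submatrix of rank at least [lam M Y + #|S|] factors through [Phi], so [Phi] has at least the rank
   of [EE]. *)
pose Phi : 'M_(k + n) := block_mx D (Q *m pr S) (pr S *m P') (pr S *m M *m pr S).
pose EE : 'M_(k + n) := block_mx E 0 0 (pr S).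
have rkEE : \rank EE = (lam M Y + #|S|)%N.
  rewrite rank_diag_block_mx rank_pr rank_pid_mx ?cutE //.
have rkPhi : (lam M Y + #|S| <= \rank Phi)%N.
  apply: leq_trans rkS _; rewrite /rho.
  have -> : pr (X :|: S) *m M *m pr (~: Y :|: S) =
      row_mx P 1%:M *m Phi *m col_mx Q' 1%:M.
    rewrite mul_row_block mul_row_col !mul1mx mulmx1 mulmxDl.
    rewrite !prU; last first.
    - by rewrite disjoint_sym disjoints_subset.
    - by rewrite disjoint_sym disjoints_subset setCK.
    rewrite mulmxDl mulmxDr !mulmxDl.
    have -> : P *m (Q *m pr S) = pr X *m M *m pr S.
      by rewrite mulmxA framePQ // -cut_sub.
    have -> : P *m D *m Q' = pr X *m M *m pr (~: Y).
      by rewrite -ED1 -mulmxA framePQ // cutE !mulmxA prS.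
    have -> : pr S *m P' *m Q' = pr S *m M *m pr (~: Y).
      by rewrite -mulmxA framePQ // cutE !mulmxA prS.
    by rewrite !addrA.
  exact: leq_trans (mxrankM_maxl _ _) (mxrankM_maxr _ _).
have PhiE : Phi^T *m EE = Phi^T.
  rewrite tr_block_mx mulmx_block !mulmx0 !addr0 !add0r.
  have trS q (A : 'M_(n, q)) : (pr S *m A)^T *m pr S = (pr S *m A)^T.
    by rewrite trmx_mul tr_pr -mulmxA pr_id.
  have trE q (A : 'M_(k, q)) : E *m A = A -> A^T *m E = A^T.
    by move=> EA; rewrite -[E]frameE_tr -trmx_mul EA.
  congr block_mx; [exact: trE|exact: trS|apply: trE; by rewrite mulmxA EQ|].
  by rewrite -mulmxA trS.
have EPhi : Phi *m EE = Phi.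
  rewrite mulmx_block !mulmx0 !addr0 !add0r ED3.
  by congr block_mx; rewrite -!mulmxA ?P'E ?pr_id.
have trEE : EE^T = EE by rewrite tr_block_mx !trmx0 tr_pr frameE_tr.
have [|Psi EPsi] := @corner_inverse _ Phi^T EE PhiE.
  by rewrite mxrank_tr rkEE.
have EEid : EE *m EE = EE.
  by rewrite mulmx_block !mulmx0 !mul0mx !addr0 !add0r pr_id frameE_id.
split=> //; split=> [c Ec1 Ec2|c d b Ec2 Ed2].
- pose v := col_mx c.1 (- (eps *: (pr S *m Q^T *m c.2))).
  pose w := EE *m (Psi^T *m v).
  have Ew : EE *m w = w by rewrite mulmxA EEid.
  (* One [Psi] serves both halves: transposing [EE = Psi *m Phi^T] provides a right inverse of
     [Phi]. *)
  have Phiw : Phi *m w = v.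
    rewrite /w mulmxA EPhi mulmxA -[Phi]trmxK -trmx_mul -EPsi trEE.
    rewrite mul_block_col !mul0mx addr0 add0r Ec1.
    by rewrite mulmxN -scalemxAr !mulmxA pr_id.
  have [b1 [u Euw]] : exists b1 u, w = col_mx b1 u.
    by exists (usubmx w), (dsubmx w); rewrite vsubmxK.
  move: Ew Phiw; rewrite Euw !mul_block_col !mul0mx addr0 add0r.
  case/eq_col_mx=> Eb1 Eu /eq_col_mx[Ev1 Ev2].
  exists (b1, D^T *m c.2 + P'^T *m u), u; split=> //=.
  + by rewrite -Ev1 -mulmxA Eu.
  + apply/eqP; rewrite -addrA addrC addr_eq0 -Ev2 addrC.
    by rewrite -(mulmxA _ (pr S)) Eu.
- case=> u [Eu Eb Ec1 Ec3 Ec4] [v [Ev _ Ed1 Ed3 Ed4]].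
  have Ew : EE *m col_mx (c.2 - d.2) (u - v) = col_mx (c.2 - d.2) (u - v).
    by rewrite mul_block_col !mul0mx addr0 add0r !mulmxBr Eu Ev Ec2 Ed2.
  have : Phi^T *m col_mx (c.2 - d.2) (u - v) = 0.
    rewrite tr_block_mx mul_block_col !trmx_mul !tr_pr symM.
    have -> : D^T *m (c.2 - d.2) + P'^T *m pr S *m (u - v) = 0.
      rewrite -mulmxA !mulmxBr Eu Ev addrACA -opprD -Ed4 -Ec4 subrr.
      by [].
    have -> : pr S *m Q^T *m (c.2 - d.2) + pr S *m (eps *: M *m pr S) *m (u - v) = 0.
      have E3 : eps *: (pr S *m Q^T *m (c.2 - d.2)) + pr S *m M *m (u - v) = 0.
        rewrite !mulmxBr scalerBr addrACA -opprD.
        by apply/eqP; rewrite subr_eq0; apply/eqP;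
          apply: (addIr (pr S *m P' *m b.1)); rewrite Ec3 Ed3.
      rewrite -!mulmxA [pr S *m (u - v)]mulmxBr Eu Ev -scalemxAl -scalemxAr.
      have := congr1 (fun A => eps *: A) E3; rewrite scalerDr scaler0 scale_epsK //.
      by rewrite -!mulmxA.
    by rewrite col_mx0.
  move=> Phi0; have : col_mx (c.2 - d.2) (u - v) = 0 by rewrite -Ew EPsi -mulmxA Phi0 mulmx0.
  rewrite -col_mx0 => /eq_col_mx[/subr0_eq E2 /subr0_eq Euv].
  case: c d {Ec2 Ed2 Ec3 Ec4 Ed3 Ed4 Ew Phi0} Ec1 Ed1 E2 => c1 c2 [d1 d2] /= -> -> ->.
  by rewrite Euv.
Qed.

(** Totality of [transfer] carries a solution on [X] over to [Y]; injectivity identifies the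
    boundary of [X] when coming back. *)
Lemma linked_bminor : exists2 phi, injective phi & bminor M M X Y phi.
Proof.
have [S [D [sS ED1 ED2 ED3 [tot inj]]]] := exists_transfer.
have sSX : S \subset ~: X by apply: subset_trans sS _; rewrite setDE subsetIr.
have sSY : S \subset Y by apply: subset_trans sS (subsetDl _ _).
have Eid : E *m E = E by exact: frameE_id.
have ex_h (c : boundary) : exists b, transfer S D (E *m c.1, E *m c.2) b.
  by apply: tot; rewrite /= mulmxA Eid.
have [h hP] := choice ex_h.
have Etr : E *m D^T = D^T by rewrite -[E]frameE_tr -trmx_mul ED3.
have EP' : E *m P'^T = P'^T by rewrite -[E]frameE_tr -trmx_mul framePE.
have EPt : E *m P^T = P^T by rewrite -EX -[frameE M X]frameE_tr -trmx_mul framePE.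
have EQ : E *m Q = Q by rewrite -EX frameEQ.
have Eh c : E *m (h c).1 = (h c).1 /\ E *m (h c).2 = (h c).2.
  have [u [_ E1 _ _ ->]] := hP c; split=> //=.
  by rewrite mulmxDr !mulmxA Etr EP'.
(* Outside the range of [E] the twist is the identity. This makes it injective on all pairs, and a
   value fixed by [E] can come only from an argument fixed by [E]. *)
pose phi c : boundary := ((h c).1 + (c.1 - E *m c.1), (h c).2 + (c.2 - E *m c.2)).
have Ephi c : E *m (phi c).1 = (h c).1 /\ E *m (phi c).2 = (h c).2.
  have [E1 E2] := Eh c.
  by rewrite /= !mulmxDr !mulmxN !mulmxA Eid E1 E2 !subrr !addr0.
have MuX (u : 'cV_n) : pr S *m u = u -> pr X *m M *m u = P *m (Q *m u).
  by move=> Eu; rewrite -{1}Eu mulmxA cut_sub // -framePQ // -!mulmxA Eu.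
have MSx (x : 'cV_n) : pr S *m M *m pr X *m x = eps *: (pr S *m Q^T *m (P^T *m x)).
  rewrite -[pr S *m M *m pr X](scale_epsK) -tr_pr_mul // cut_sub // -framePQ //.
  by rewrite !trmx_mul tr_pr -scalemxAl !mulmxA.
exists phi.
  move=> c d Ecd; have hcd : h c = h d.
    have [E1 E2] := Ephi c; have [E3 E4] := Ephi d.
    by rewrite [h c]surjective_pairing -E1 -E2 Ecd E3 E4 -surjective_pairing.
  have := hP d; rewrite -hcd => /(inj _ _ _ _ _ (hP c)) /=.
  rewrite !mulmxA Eid => /(_ erefl erefl) [E1 E2].
  have Ec1 : c.1 = d.1 by move: (congr1 fst Ecd); rewrite /= hcd E1 => /addrI/addIr.
  have Ec2 : c.2 = d.2 by move: (congr1 snd Ecd); rewrite /= hcd E2 => /addrI/addIr.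
  by rewrite [c]surjective_pairing Ec1 Ec2 -surjective_pairing.
exists id, S; rewrite imset_id; split=> // x y c; split.
- case=> E1 E2 E3; rewrite EX in E3.
  have E4 : E *m c.2 = c.2 by rewrite E2 mulmxA EPt.
  have phic : phi c = h c.
    by rewrite /phi E3 E4 !subrr !addr0 -surjective_pairing.
  have := hP c; rewrite E3 E4 -phic; move: (phi c) => b [u [/= Eu Eb Ec1 Ec2 Eb2]].
  (* The solution [u] fills in the contracted vertices and 0 the deleted ones; [y'] is then dictated
     by the equation on [Y :\: X]. *)
  pose x' := pr X *m x + u.
  pose y' := pr X *m y + pr (Y :\: X) *m (M *m x' + P' *m b.1).
  have Yx' : pr Y *m x' = x'.
    by rewrite mulmxDr mulmxA prSr // -{1}Eu mulmxA prSr // Eu.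
  have prY : pr Y = pr X + pr (Y :\: X).
    rewrite -prU; last by rewrite -setI_eq0 setDE setICA setICr setI0.
    congr pr; apply/setP=> i; have /implyP := subsetP sXY i; rewrite !inE.
    by case: (i \in X) (i \in Y) => [] [].
  have Xx' : pr X *m M *m x' + P *m (D *m b.1) = pr X *m y.
    rewrite mulmxDr (MuX _ Eu) E1 -[in RHS]mulmxA Ec1 mulmxDr -addrA.
    by rewrite [P *m (Q *m u) + _]addrC !mulmxA.
  have Sx' : pr S *m (M *m x' + P' *m b.1) = 0.
    rewrite mulmxDr !mulmxA mulmxDr [_ *m (pr X *m x)]mulmxA MSx -E2.
    by rewrite -Ec2.
  exists x', y'; split.
  + split=> //.
      rewrite -(mulmxA _ (pr Y)) Yx' mulmxDr mulmxA prSr // mulmxA prSr ?subsetDl //.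
      rewrite mulmxDr addrA [pr Y]prY mulmxDl mulmxDl -Xx' !mulmxA.
      have {2}-> : P' = pr X *m P' + pr (Y :\: X) *m P' by rewrite -mulmxDl -prY pr_frameP.
      by rewrite mulmxDl ED1 addrACA !addrA.
    by rewrite Eb2 E2 mulmxDr !mulmxA; congr (_ *m x + _); rewrite -[pr X]tr_pr -!trmx_mul ED1.
  + move=> i iX; rewrite [x' _ _]mxE [y' _ _]mxE !mul_prE iX inE iX addr0; split=> //.
    rewrite -Eu mul_prE ifF ?addr0 //; apply/negbTE.
    by apply: contraL iX => /(subsetP sSX); rewrite inE.
  + move=> j; rewrite inE => /andP[njX jY].
    case: ifPn => jS.
      rewrite [y' _ _]mxE !mul_prE (negbTE njX) inE njX jY add0r.
      by have := congr1 (fun A : 'cV_n => A j 0) Sx'; rewrite mul_prE jS => ->; rewrite mxE.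
    by rewrite [x' _ _]mxE mul_prE (negbTE njX) -Eu mul_prE (negbTE jS) addr0.
- case=> x' [y' [[E1 E2 E3] keep out]].
  have Xx : pr X *m x = pr X *m x'.
    by apply: pr_mulP => i iX j; rewrite (ord1 j); have [<- _] := keep _ iX.
  have Xy : pr X *m y = pr X *m y'.
    by apply: pr_mulP => i iX j; rewrite (ord1 j); have [_ <-] := keep _ iX.
  have Yx' : pr Y *m x' = pr X *m x + pr S *m x'.
    rewrite Xx; apply/matrixP=> i j; rewrite [RHS]mxE !mul_prE (ord1 j).
    have [iX|niX] := boolP (i \in X).
      rewrite (subsetP sXY _ iX) ifF ?addr0 //; apply/negbTE.
      by apply: contraL iX => /(subsetP sSX); rewrite inE.
    rewrite add0r; have [iS|niS] := boolP (i \in S); first by rewrite (subsetP sSY _ iS).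
    case: ifP => // iY; have := out i; rewrite inE niX iY (negbTE niS).
    by apply.
  have Sy' : pr S *m y' = 0.
    apply/matrixP=> i j; rewrite mul_prE mxE (ord1 j); case: ifP => // iS.
    by have := out i (subsetP sS _ iS); rewrite iS.
  have [b Eb0] : exists b, b = phi c by exists (phi c).
  rewrite -Eb0 in E1 E2 E3.
  have [u Eu0] : exists u, u = pr S *m x' by exists (pr S *m x').
  have Eu : pr S *m u = u by rewrite Eu0 mulmxA pr_id.
  rewrite -Eu0 in Yx'.
  pose d : boundary := (D *m b.1 + Q *m u, P^T *m x).
  have Eb2 : E *m b.2 = b.2 by rewrite E2 mulmxA EP'.
  have [hb1 hb2] := Ephi c; rewrite -Eb0 E3 Eb2 in hb1 hb2.
  have bh : h c = b by rewrite [h c]surjective_pairing -hb1 -hb2 -surjective_pairing.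
  have Ec : c = (E *m c.1, E *m c.2).
    have cancel (z1 z2 z3 : 'cV[F]_k) : z1 + (z2 - z3) = z1 -> z3 = z2.
      by rewrite -[RHS]addr0 => /addrI/subr0_eq.
    have /cancel -> : b.1 + (c.1 - E *m c.1) = b.1 by rewrite -{1}bh Eb0.
    have /cancel -> : b.2 + (c.2 - E *m c.2) = b.2 by rewrite -{1}bh Eb0.
    exact: surjective_pairing.
  have tb : transfer S D d b.
    exists u; split=> //.
      have := congr1 (mulmx (pr S)) E1.
      rewrite !mulmxA prS // Sy' mulmxDr !mulmxA prS // -(mulmxA _ (pr Y)) Yx'.
      rewrite mulmxDr [_ *m (pr X *m x)]mulmxA MSx => h4.
      by rewrite -[X in eps *: X]mulmxA -h4.
    have -> : b.2 = P'^T *m (pr Y *m x').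
      by rewrite E2 -{1}(pr_frameP Yk) trmx_mul tr_pr mulmxA.
    rewrite Yx' mulmxDr; congr (_ + _).
    by rewrite !mulmxA -[pr X]tr_pr -!trmx_mul ED1.
  have Ed : c = d.
    have tc : transfer S D c b by rewrite {1}Ec -bh.
    have Ed2 : E *m d.2 = d.2 by rewrite /d /= mulmxA EPt.
    have Ec2 : E *m c.2 = c.2 by have := congr1 snd Ec => /= <-.
    exact: inj tc tb.
  rewrite Ed; split=> //=; last by rewrite EX mulmxDr !mulmxA ED2 EQ.
  have := congr1 (mulmx (pr X)) E1.
  rewrite !mulmxA prS // -Xy => ->; rewrite mulmxDr !mulmxA prS // -(mulmxA _ (pr Y)) Yx'.
  rewrite mulmxDr (MuX _ Eu) ED1 !mulmxDr -addrA [P *m (Q *m u) + _]addrC.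
  by rewrite !mulmxA.
Qed.

End Linking.

End BoundariedMatrices.

(** * Well-quasi-ordering of linked trees *)

Section BoundariedWqo.
Variables (F : finFieldType) (k : nat) (eps : F).
Hypothesis eps2 : (eps * eps = 1)%R.

Record item : Type := Item {
  item_dim : nat;
  item_mx : 'M[F]_item_dim;
  item_tree : dtree 'I_item_dim
}.

Implicit Types (d e : item) (P G : item -> Prop).

Definition item_set e : {set 'I_(item_dim e)} := leaves (item_tree e).
Definition item_label e : nat := lam (item_mx e) (item_set e).
Definition item_size e : nat := tree_size (item_tree e).

Definition good e : Prop :=
  [/\ (item_mx e)^T%R = (eps *: item_mx e)%R, disjoint_leaves (item_tree e),
      width_le (lam (item_mx e)) k (item_tree e) &
      linked (lam (item_mx e)) (item_tree e)].

Definition le_twist phi e e' : Prop :=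
  @bminor F k _ _ (item_mx e) (item_mx e') (item_set e) (item_set e') phi.
Definition le_id e e' : Prop := le_twist id e e'.
Definition le_ex e e' : Prop := exists2 phi, injective phi & le_twist phi e e'.

Lemma le_id_trans e e' e'' : le_id e e' -> le_id e' e'' -> le_id e e''.
Proof. by move=> h1 h2; have := bminor_trans h1 h2. Qed.

Lemma le_ex_trans e e' e'' : le_ex e e' -> le_ex e' e'' -> le_ex e e''.
Proof.
move=> [phi inj h1] [phi' inj' h2]; exists (phi' \o phi); first exact: inj_comp.
exact: bminor_trans h1 h2.
Qed.

Lemma le_id_ex e e' : le_id e e' -> le_ex e e'.
Proof. by exists id. Qed.

(* Composing the twists along an infinite chain, two of the finitely many
   partial compositions agree, and the twist between them is the identity. *)
Lemma wqo_le_ex_id P : wqo P le_ex -> wqo P le_id.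
Proof.
move=> wqoP f Pf; have [g g_incr chain] := wqo_subseq wqoP Pf.
have chain' i : exists phi, injective phi /\ le_twist phi (f (g i)) (f (g i.+1)).
  by have [phi inj h] := chain i; exists phi.
have [phi phiP] := choice chain'.
pose fix Psi n := if n is m.+1 then phi m \o Psi m else id.
have Psi_inj n : injective (Psi n).
  by elim: n => [|n IH] //=; apply: inj_comp IH; case: (phiP n).
have between i j : i < j -> exists2 chi, Psi j =1 chi \o Psi i &
    le_twist chi (f (g i)) (f (g j)).
  elim: j => // j IH; rewrite ltnS leq_eqVlt => /orP[/eqP <-|/IH[chi E h]].
    by exists (phi i) => //; case: (phiP i).
  exists (phi j \o chi) => [c|]; first by rewrite /= E.
  by apply: bminor_trans h _; case: (phiP j).
have [i [j [ij Eij]]] := pigeonhole (fun n => [ffun c => Psi n c]).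
exists (g i), (g j); split; first exact: g_incr.
have [chi E h] := between _ _ ij.
suff Echi : chi = id by rewrite Echi in h.
apply/funext=> c; have [h' _ hK] := injF_bij (Psi_inj i).
have := E (h' c); rewrite /= hK => <-.
by have := congr1 (fun t : {ffun _ -> _} => t (h' c)) Eij; rewrite !ffunE hK.
Qed.

Section LeafRel.
Variables (n : nat) (M : 'M[F]_n) (v : 'I_n) (X : {set 'I_n}).
Local Open Scope ring_scope.
Hypothesis sX : X \subset [set v].
Hypothesis Xk : (lam M X <= k)%N.
Local Notation P := (frameP k M X).

Lemma leaf_relE x y c : boundary_rel M X x y c <->
  [/\ v \in X -> y v 0 = M v v * x v 0 + (row v P *m c.1) 0 0,
      c.2 = (if v \in X then x v 0 else 0) *: (row v P)^T & frameE k M X *m c.1 = c.1].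
Proof.
have Xv i : i \in X -> i = v by move=> /(subsetP sX) /set1P.
have rowP : (row v P *m c.1) 0 0 = (P *m c.1) v 0 by rewrite -row_mul mxE.
have P0 i j : i \notin X -> P i j = 0.
  by move=> /negbTE niX; rewrite -(pr_frameP Xk) mul_prE niX.
have Ptx : P^T *m x = (if v \in X then x v 0 else 0) *: (row v P)^T.
  apply/matrixP=> i j; rewrite mxE (ord1 j) (bigD1 v) //= big1 ?addr0 => [|w wv].
    rewrite 4!mxE; case: ifPn => [_|nv]; first by rewrite mulrC.
    by rewrite P0 // !mul0r.
  rewrite mxE P0 ?mul0r //; by apply: contra wv => /Xv ->.
have diag : v \in X -> (pr F X *m M *m pr F X *m x) v 0 = M v v * x v 0.
  move=> vX; rewrite -!mulmxA mul_prE vX mxE (bigD1 v) //= mul_prE vX.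
  rewrite big1 ?addr0 // => w wv; rewrite mul_prE ifF ?mulr0 //; apply/negbTE.
  by apply: contra wv => /Xv ->.
split=> [[E1 E2 E3]|[E1 E2 E3]]; split=> //; try by rewrite -Ptx.
- move=> vX; have := congr1 (fun A : 'cV_n => A v 0) E1.
  by rewrite mul_prE vX [RHS]mxE diag // rowP.
- apply/matrixP=> i j; rewrite (ord1 j) mul_prE [RHS]mxE.
  have [iX|niX] := boolP (i \in X).
    by have := iX; rewrite (Xv _ iX) => vX; rewrite diag // -rowP E1.
  rewrite -!mulmxA mul_prE (negbTE niX) add0r mxE big1 // => j' _.
  by rewrite P0 // mul0r.
- by rewrite Ptx.
Qed.

End LeafRel.

(** By [leaf_relE] these data, from a finite type, determine the boundary relation of a leaf. The
    value at a [Node] is a dummy. *)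
Definition leaf_data e : bool * F * 'rV[F]_k * 'M[F]_k :=
  match item_tree e with
  | Leaf v b => (v \in item_set e, item_mx e v v,
      row v (frameP k (item_mx e) (item_set e)), frameE k (item_mx e) (item_set e))
  | Node _ _ => (true, 0%R, 0%R, 0%R)
  end.

Definition is_Leaf e : bool := if item_tree e is Leaf _ _ then true else false.

Lemma bminor_leaf n n' (M : 'M[F]_n) (M' : 'M[F]_n') v v' (X : {set 'I_n})
    (X' : {set 'I_n'}) : X \subset [set v] -> X' \subset [set v'] ->
    lam M X <= k -> lam M' X' <= k -> (v \in X) = (v' \in X') -> M v v = M' v' v' ->
    row v (frameP k M X) = row v' (frameP k M' X') -> frameE k M X = frameE k M' X' ->
  @bminor F k _ _ M M' X X' id.
Proof.
move=> sX sX' Xk Xk' Eb EM EP EE.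
have Xv w : w \in X -> w = v by move=> /(subsetP sX) /set1P.
have Xv' w : w \in X' -> w = v' by move=> /(subsetP sX') /set1P.
exists (fun=> v'), set0; split.
- by move=> w w' /Xv -> /Xv ->.
- by apply/subsetP=> w /imsetP[u uX ->]; rewrite -Eb -(Xv _ uX).
move=> x y c; split.
  move=> /(leaf_relE sX Xk)[E1 E2 E3].
  exists (const_mx (x v 0%R)), (const_mx (y v 0%R)); split.
  - apply/(leaf_relE sX' Xk'); rewrite -Eb -EM -EP -EE.
    have cE (a : F) : const_mx a v' 0%R = a :> F by rewrite mxE.
    by split; rewrite ?cE.
  - by move=> w /Xv ->; rewrite !mxE.
  - move=> w; rewrite !inE => /andP[nw wX']; case/negP: nw.
    have vX : v \in X by rewrite Eb -(Xv' _ wX').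
    by rewrite (Xv' _ wX'); apply/imsetP; exists v.
case=> x' [y' [/(leaf_relE sX' Xk')[E1 E2 E3] keep _]].
apply/(leaf_relE sX Xk); rewrite Eb EM EP EE; split=> //.
  move=> vX'; have [|<- <-] := keep v; first by rewrite Eb.
  exact: E1.
rewrite E2; case: ifP => // vX'; have [|<- _] := keep v; by rewrite ?Eb.
Qed.

Lemma wqo_leaves : wqo (fun e => good e /\ is_Leaf e) le_id.
Proof.
move=> f Pf; have [i [j [ij E]]] := pigeonhole (fun i => leaf_data (f i)).
exists i, j; split=> //; move: (Pf i) (Pf j) E.
have sub m (w : 'I_m) c : leaves (Leaf w c) \subset [set w].
  by case: c => //=; exact: sub0set.
case: (f i) => n M [v b|l r] [[/= _ _ + _] //= _]; rewrite width_leE andbT => wd.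
case: (f j) => n' M' [v' b'|l r] [[/= _ _ + _] //= _]; rewrite width_leE andbT => wd'.
by case=> E1 E2 E3 E4; apply: (@bminor_leaf _ _ _ _ v v') => //; exact: sub.
Qed.

Definition left_item e : item :=
  Item (item_mx e) (if item_tree e is Node l _ then l else item_tree e).
Definition right_item e : item :=
  Item (item_mx e) (if item_tree e is Node _ r then r else item_tree e).

Lemma good_left n (M : 'M[F]_n) l r : good (Item M (Node l r)) -> good (Item M l).
Proof.
case=> /= symM /and3P[_ wl _]; rewrite width_leE => /and3P[_ wdl _] [_ [ll _]].
by split.
Qed.

Lemma good_right n (M : 'M[F]_n) l r : good (Item M (Node l r)) -> good (Item M r).
Proof.
case=> /= symM /and3P[_ _ wr]; rewrite width_leE => /and3P[_ _ wdr] [_ [_ lr]].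
by split.
Qed.

Lemma good_label e : good e -> item_label e <= k.
Proof. by case=> _ _; rewrite width_leE => /andP[]. Qed.

(** One passes to a subsequence with increasing left children, then to one with increasing right
    children too. Among its terms two have the same gluing, and [bminor_glue] applies to them. *)
Lemma wqo_nodes P : wqo P le_id ->
  wqo (fun e => [/\ good e, ~~ is_Leaf e, P (left_item e) & P (right_item e)]) le_id.
Proof.
move=> wqoP f Pf.
have [g1 g1_incr chain1] : exists2 g : nat -> nat, (forall i j, i < j -> g i < g j) &
    forall i j, i < j -> le_id (left_item (f (g i))) (left_item (f (g j))).
  by apply: (@wqo_chain _ P le_id (left_item \o f)) => // [|i];
    [exact: le_id_trans|case: (Pf i)].
have [g2 g2_incr chain2] : exists2 g : nat -> nat, (forall i j, i < j -> g i < g j) &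
    forall i j, i < j -> le_id (right_item (f (g1 (g i)))) (right_item (f (g1 (g j)))).
  by apply: (@wqo_chain _ P le_id (right_item \o f \o g1)) => // [|i];
    [exact: le_id_trans|case: (Pf (g1 i))].
have ex_o i : exists o : gluing F k, forall x y c,
    boundary_rel (item_mx (f i))
      (item_set (left_item (f i)) :|: item_set (right_item (f i))) x y c <->
    exists c' c'', [/\ boundary_rel (item_mx (f i)) (item_set (left_item (f i))) x y c',
      boundary_rel (item_mx (f i)) (item_set (right_item (f i))) x y c'' &
      glue_rel eps o c c' c''].
  case: (Pf i); case: (f i) => n M [//|l r] gd _ _ _.
  case: (gd) => /= symM /and3P[d _ _] _ _.
  apply: (exists_gluing eps2 symM d).
  - exact: good_label (good_left gd).
  - exact: good_label (good_right gd).
  - exact: good_label gd.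
have [o oP] := choice ex_o.
have [i [j [ij E]]] := @pigeonhole ('M[F]_k * 'M[F]_k * ('M[F]_k * 'M[F]_k))%type
  (fun i => o (g1 (g2 i))).
have lt2 := g2_incr _ _ ij; have lt1 := g1_incr _ _ lt2.
exists (g1 (g2 i)), (g1 (g2 j)); split=> //.
have h1 := chain1 _ _ lt2; have h2 := chain2 _ _ ij.
have glue := oP (g1 (g2 i)); have glue' := oP (g1 (g2 j)); rewrite -E in glue'.
move: (o _) h1 h2 glue glue' (Pf (g1 (g2 i))) (Pf (g1 (g2 j))) => o0.
move: (f (g1 (g2 i))) (f (g1 (g2 j))) => [n M [v b|l r]] [n' M' [v' b'|l' r']];
  try by move=> _ _ _ _ [] // _ _ _ _ [].
move=> h1 h2 glue glue' [gd _ _ _] [gd' _ _ _].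
case: (gd) => /= _ /and3P[d _ _] _ _; case: (gd') => /= _ /and3P[d' _ _] _ _.
apply: (bminor_glue d d' _ _ glue glue' h1 h2).
- exact: good_label (good_left gd').
- exact: good_label (good_right gd').
Qed.

(** Elements of [G] play the role of leaves: they may be large trees, and their labels are not
    bounded below by [s]. *)
Inductive built s G : item -> Prop :=
  | built_base e : G e -> built s G e
  | built_Node n (M : 'M[F]_n) l r : good (Item M (Node l r)) ->
      s <= item_label (Item M (Node l r)) ->
      built s G (Item M l) -> built s G (Item M r) -> built s G (Item M (Node l r)).

(** The nonempty path makes [d] a proper subtree, so that [item_size] drops. *)
Definition below s d e : Prop := exists T b p,
  e = Item (item_mx d) T /\ at_path (lam (item_mx d)) s (b :: p) T (item_tree d).

Lemma below_size s d e : below s d e -> item_size d < item_size e.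
Proof.
case=> T [b [p [-> /at_path_size le]]]; apply: leq_trans le.
by rewrite addnS ltnS leq_addr.
Qed.

Lemma below_child s n (M : 'M[F]_n) l r e : below s (Item M (Node l r)) e ->
  (s <= item_label (Item M l) -> below s (Item M l) e) /\
  (s <= item_label (Item M r) -> below s (Item M r) e).
Proof.
case=> T [b [p [Ee path]]]; split=> le; exists T, b.
  exists (rcons p false); split=> //.
  exact: (@at_path_rcons _ _ _ (b :: p) _ _ _ false path).
exists (rcons p true); split=> //.
exact: (@at_path_rcons _ _ _ (b :: p) _ _ _ true path).
Qed.

Lemma below_le s d e : good e -> item_label e = s -> item_label d = s ->
  below s d e -> le_ex d e.
Proof.
move=> gd eT eU [T [b [p [Ee path]]]]; move: gd eT; rewrite Ee {e Ee} => gd eT.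
have Tk := good_label gd; case: gd => /= symM _ _.
rewrite -eT in path eU; case: T path eT eU Tk => [//|l r] path eT eU Tk [root _].
apply: (linked_bminor eps2 symM (at_path_sub path) eU Tk) => Z sUZ sZT.
exact: root path eU Z sUZ sZT.
Qed.

Lemma built_wqo s G : (forall e, G e -> good e) -> wqo G le_id -> wqo (built s G) le_id.
Proof.
move Em : (k.+1 - s) => m; elim: m s Em G => [|m IH] s Em G goodG wqoG.
  (* Here [s] exceeds [k], so no good node has label at least [s] and only [G] remains. *)
  apply: wqo_sub wqoG => e [] // n M l r gd le _ _.
  by have := good_label gd; move: Em le; clear; lia.
pose A e := [/\ built s G e, good e & item_label e = s].
(* Once trees of label exactly [s] may serve as leaves, all nodes above them have label at least
   [s.+1]. *)
suff wqoA : wqo A le_ex.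
  have wqoGA : wqo (fun e => G e \/ A e) le_id.
    by apply: wqo_union wqoG _; exact: wqo_le_ex_id.
  have goodGA e : G e \/ A e -> good e by case=> [/goodG|[]].
  apply: wqo_sub (IH s.+1 _ _ goodGA wqoGA); last by move: Em; clear; lia.
  move=> e; elim=> [d Gd|n M l r gd le bl IHl br IHr].
    by apply: built_base; left.
  have [E|ne] := eqVneq (item_label (Item M (Node l r))) s.
    by apply: built_base; right; split=> //; exact: built_Node.
  by apply: built_Node => //; rewrite ltn_neqAle eq_sym ne.
apply: contrapT => /(minimal_bad_sequence item_size)[f [Af bad minf]].
pose A' d := A d /\ exists i, below s d (f i).
have A'_le d i : A d -> below s d (f i) -> le_ex d (f i).
  by case=> _ _ ld; case: (Af i) => _ gf lf; exact: below_le.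
have wqoA' : wqo A' le_ex.
  apply: contrapT => /existsNP[h /not_implyP[A'h badh]].
  have [idx idxP] := choice (fun n => (A'h n).2).
  have exi : exists m, `[< exists n, idx n = m >].
    by exists (idx 0); apply/asboolP; exists 0.
  case: (ex_minnP exi) => i0 /asboolP[n0 En0] min0.
  (* The beginning of the minimal bad sequence is continued by the bad sequence of subtrees, from a
     term whose host has the least index [i0]. A comparison across the seam would give one inside
     [f], since a subtree is below its host by linkedness. *)
  pose h' j := if j < i0 then f j else h (n0 + (j - i0)).
  have Ah' j : A (h' j).
    by rewrite /h'; case: ifP => // _; case: (A'h (n0 + (j - i0))).
  have eqh' j : j < i0 -> h' j = f j by rewrite /h' => ->.
  have badh' j l : j < l -> ~ le_ex (h' j) (h' l).
    move=> jl; rewrite /h'; case: (ltnP l i0) => [li|il].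
      by rewrite (ltn_trans jl li); exact: bad.
    case: (ltnP j i0) => [ji|ij] le_jl.
      have le_i : i0 <= idx (n0 + (l - i0)).
        by apply: min0; apply/asboolP; exists (n0 + (l - i0)).
      have := le_ex_trans le_jl (A'_le _ _ (A'h _).1 (idxP _)).
      by apply: bad; exact: leq_trans ji le_i.
    apply: badh; exists (n0 + (j - i0)), (n0 + (l - i0)); split=> //.
    by move: jl ij; clear; lia.
  have := minf i0 h' Ah' eqh' badh'.
  rewrite /h' ltnn subnn addn0 leqNgt -En0.
  by rewrite (below_size (idxP n0)).
have wqoGA' : wqo (fun e => G e \/ A' e) le_id.
  by apply: wqo_union wqoG _; exact: wqo_le_ex_id.
have goodGA' e : G e \/ A' e -> good e by case=> [/goodG|[[]]].
have wqoK : wqo (built s.+1 (fun e => G e \/ A' e)) le_id.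
  by apply: IH => //; move: Em; clear; lia.
(* The subtree is cut at its topmost nodes of label [s], which belong to [A']. The condition on
   [below] is guarded because elements of [G] may have labels under [s]. *)
have descend d i : built s G d -> (s <= item_label d -> below s d (f i)) ->
    built s.+1 (fun e => G e \/ A' e) d.
  elim=> {d} [d Gd _|n M l r gd le bl IHl br IHr bel]; first by apply: built_base; left.
  have {}bel := bel le; have [bell belr] := below_child bel.
  have [E|ne] := eqVneq (item_label (Item M (Node l r))) s.
    apply: built_base; right; split; last by exists i.
    by split=> //; exact: built_Node.
  apply: built_Node => //; first by rewrite ltn_neqAle eq_sym ne.
    exact: IHl.
  exact: IHr.
have wqoU := wqo_union wqoG (wqo_nodes wqoK).
have [i [j [ij le]]] : exists i j, i < j /\ le_id (f i) (f j).
  apply: wqoU => i; case: (Af i) => bf gf _.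
  have := descend^~ i; move: gf; case: bf => [e Ge _ _|n M l r gd le bl br _ desc].
    by left.
  right; split=> //; apply: desc => //= le'; exists (Node l r).
    by exists false, [::].
  by exists true, [::].
exact: bad ij (le_id_ex le).
Qed.

Theorem good_wqo : wqo good le_id.
Proof.
apply: wqo_sub (built_wqo (s := 0) (fun e (h : good e /\ is_Leaf e) => h.1) wqo_leaves).
case=> n M T; elim: T => [v b|l IHl r IHr] gd; first by apply: built_base.
by apply: built_Node => //; [apply: IHl; exact: good_left gd|apply: IHr; exact: good_right gd].
Qed.

End BoundariedWqo.

(** * From contractions and deletions to a Schur complement *)

Section SchurExtraction.
Variables (F : fieldType) (eps : F).
Local Open Scope ring_scope.
Hypothesis eps2 : eps * eps = 1.

(** [B] indexes a row basis of the block on [S]. By symmetry the same dependencies hold between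
    columns, so the block is [K *m (pr F B *m M *m pr F B) *m K^T]; hence the block on [B] has rank
    at least [#|B|]. *)
Lemma principal_row_basis n (M : 'M[F]_n) (S : {set 'I_n}) : M^T = eps *: M ->
  exists B : {set 'I_n}, [/\ B \subset S, principal_submatrix M B \in unitmx &
    exists K, pr F S *m M *m pr F S = K *m (pr F B *m M *m pr F S)].
Proof.
move=> symM.
have [N NE0] : exists N, N = pr F S *m M *m pr F S by exists (pr F S *m M *m pr F S).
(* Intersecting with [S] discards no information, as rows of [N] outside [S] vanish. *)
pose f := maxrankfun N; pose B := [set f i | i in 'I_(\rank N)] :&: S.
have sB : B \subset S by exact: subsetIr.
have cardB : (#|B| <= \rank N)%N.
  rewrite -[X in (_ <= X)%N]card_ord; apply: leq_trans (leq_imset_card f _).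
  exact/subset_leq_card/subsetIl.
have [K EK] : exists K, N = K *m (pr F B *m M *m pr F S).
  apply/submxP; rewrite -(eq_maxrowsub N); apply/row_subP=> i.
  have -> : row i (rowsub f N) = row (f i) (pr F B *m M *m pr F S).
    apply/rowP=> j; rewrite [LHS]mxE [LHS]mxE [RHS]mxE.
    have NE w : N w j = (pr F S *m (M *m pr F S)) w j by rewrite NE0 mulmxA.
    by rewrite NE -mulmxA !mul_prE inE imset_f.
  exact: row_sub.
exists B; split=> //; last by exists K; rewrite -NE0.
have symN : N^T = eps *: N by rewrite NE0; exact: tr_pr_mul.
have NB : pr F B *m N = pr F B *m M *m pr F S by rewrite NE0 !mulmxA prS.
have EK2 : N = K *m (pr F B *m N) by rewrite NB.
have EK' : N = N *m pr F B *m K^T.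
  have := congr1 trmx EK2; rewrite !trmx_mul tr_pr symN -!scalemxAl.
  by move/(congr1 (fun A => eps *: A)); rewrite !scale_epsK.
have EN : N = K *m (pr F B *m M *m pr F B) *m K^T.
  have -> : K *m (pr F B *m M *m pr F B) = K *m (pr F B *m N) *m pr F B.
    by rewrite NB -!mulmxA prSr.
  by rewrite -EK2 -EK'.
rewrite -row_free_unit /row_free rank_submatrix eqn_leq.
rewrite -{1}(rank_submatrix M B B) rank_leq_row.
apply: leq_trans cardB _; rewrite [in X in (X <= _)%N]EN.
exact: leq_trans (mxrankM_maxl _ _) (mxrankM_maxr _ _).
Qed.

(** The contracted block may be singular, so only a row basis [B] of it is pivoted on, and the rest
    of [S0] is deleted. The two operations agree because the hypothesis guarantees a solution with
    [y = 0] on all of [S0]. *)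
Lemma minor_schur n n' (M : 'M[F]_n) (M' : 'M[F]_n') (iota : 'I_n -> 'I_n')
    (S : {set 'I_n'}) : M'^T = eps *: M' -> injective iota ->
    (forall x y : 'cV[F]_n, y = M *m x <-> exists x' : 'cV[F]_n',
      [/\ forall i, x' (iota i) 0 = x i 0, forall i, (M' *m x') (iota i) 0 = y i 0 &
        forall j, j \notin codom iota ->
          if j \in S then (M' *m x') j 0 = 0 else x' j 0 = 0]) ->
  exists Y : {set 'I_n'}, principal_submatrix M' Y \in unitmx /\
    exists Z : {set 'I_#|~: Y|},
      matrix_isomorphic M (principal_submatrix (schur_complement M' Y) Z).
Proof.
move=> symM' inj rel; pose S0 := S :&: [set j | j \notin codom iota].
have [B [sB unitB [K EK]]] := principal_row_basis S0 symM'.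
have iotaS i : iota i \notin S0 by rewrite !inE codom_f andbF.
have iotaB i : iota i \notin B by apply: contra (iotaS i); exact: subsetP sB _.
exists B; split=> //.
pose sel := @selector F n' B; pose J := invmx (principal_submatrix M' B).
pose Sch := M' - M' *m sel^T *m J *m sel *m M'.
have selJ : sel *m M' *m sel^T *m J = 1%:M.
  by rewrite -submatrixE mulmxV.
have prBsel : pr F B *m sel^T = sel^T.
  by rewrite -selector_tr_mul -mulmxA selector_mul_tr mulmx1.
have selS0 : pr F S0 *m sel^T = sel^T by rewrite -prBsel mulmxA prSr.
have entry i j : M i j = Sch (iota i) (iota j).
  pose e : 'cV[F]_n' := delta_mx (iota j) 0.
  (* [x'] modifies the unit vector on [B] alone, so as to make [y] vanish on [B]; the resulting [y]
     is a column of the Schur complement. *)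
  pose z := J *m (sel *m (M' *m e)); pose x' := e - sel^T *m z.
  have My : M' *m x' = Sch *m e by rewrite mulmxBr mulmxBl !mulmxA.
  have prBy : pr F B *m (M' *m x') = 0.
    have sy : sel *m (M' *m x') = 0.
      by rewrite /x' !mulmxBr /z !mulmxA selJ mul1mx subrr.
    by rewrite -selector_tr_mul -mulmxA sy mulmx0.
  (* The solution [x1] given by [rel] shows that [M' *m e], restricted to [S0], is in the column
     space of the block on [S0]. It therefore obeys the row dependencies [K], and [y = 0] on [B]
     forces [y = 0] on [S0]. *)
  have prSe : pr F S0 *m (M' *m e) = K *m (pr F B *m (M' *m e)).
    have /rel[x1 [x1i _ x1S]] : M *m delta_mx j 0 = M *m (delta_mx j 0 : 'cV_n) by [].
    have Ex1 : x1 = e + pr F S0 *m x1.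
      apply/matrixP=> w c; rewrite [RHS]mxE mul_prE (ord1 c).
      have [/codomP[i' ->]|nw] := boolP (w \in codom iota).
        by rewrite (negbTE (iotaS i')) addr0 x1i !mxE (inj_eq inj).
      rewrite !inE nw andbT [e _ _]mxE.
      have -> : (w == iota j) = false by apply: contraNF nw => /eqP ->; exact: codom_f.
      by rewrite /= add0r; have := x1S _ nw; case: (w \in S).
    have S0x1 : pr F S0 *m (M' *m x1) = 0.
      apply/matrixP=> w c; rewrite mul_prE [RHS]mxE (ord1 c); case: ifP => //.
      by rewrite !inE => /andP[wS nw]; have := x1S _ nw; rewrite wS.
    have Bx1 : pr F B *m (M' *m x1) = 0 by rewrite -(prS F sB) -mulmxA S0x1 mulmx0.
    have e1 : pr F S0 *m (M' *m e) = - (pr F S0 *m M' *m pr F S0 *m x1).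
      apply/eqP; rewrite -addr_eq0 -!mulmxA -mulmxDr -mulmxDr -Ex1 S0x1.
      by [].
    have e2 : pr F B *m (M' *m e) = - (pr F B *m M' *m pr F S0 *m x1).
      apply/eqP; rewrite -addr_eq0 -!mulmxA -mulmxDr -mulmxDr -Ex1 Bx1.
      by [].
    by rewrite e1 e2 EK mulmxN !mulmxA.
  have prSy : pr F S0 *m (M' *m x') = 0.
    have -> : pr F S0 *m (M' *m x') = K *m (pr F B *m (M' *m x')).
      rewrite !mulmxBr prSe; congr (_ - _).
      rewrite -selS0 !mulmxA EK.
      by rewrite !mulmxA.
    by rewrite prBy mulmx0.
  have x'B w : w \notin B -> x' w 0 = e w 0.
    move=> nw; rewrite mxE [X in _ + X]mxE -prBsel -mulmxA mul_prE (negbTE nw).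
    by rewrite subr0.
  have yM : \col_i (M' *m x') (iota i) 0 = M *m delta_mx j 0 :> 'cV_n.
    apply/rel; exists x'; split=> [i'|i'|w nw]; last 1 first.
    - case: ifPn => wS.
        have wS0 : w \in S0 by rewrite !inE wS.
        by have := congr1 (fun A : 'cV_n' => A w 0) prSy; rewrite mul_prE wS0 [RHS]mxE.
      rewrite x'B; last by apply: contra wS => /(subsetP sB); rewrite inE => /andP[].
      rewrite mxE; have -> // : (w == iota j) = false.
      by apply: contraNF nw => /eqP ->; exact: codom_f.
    - by rewrite x'B // !mxE (inj_eq inj).
    - by rewrite [RHS]mxE.
  have := congr1 (fun A : 'cV_n => A i 0) yM.
  rewrite My [LHS]mxE -!colE [in LHS]mxE [in RHS]mxE.
  by move=> ->.
have schurE a b : schur_complement M' B a b = Sch (enum_val a) (enum_val b).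
  have -> : schur_complement M' B = submatrix Sch (~: B) (~: B).
    rewrite /schur_complement !submatrixE /Sch mulmxBr mulmxBl -submatrixE.
    by rewrite !mulmxA.
  by rewrite mxE.
pose Z := [set a : 'I_#|~: B| | enum_val a \in codom iota]; exists Z.
have ex_f i : exists z : 'I_#|Z|, enum_val (enum_val z) = iota i.
  have iB : iota i \in ~: B by rewrite inE.
  have aZ : enum_rank_in iB (iota i) \in Z by rewrite inE enum_rankK_in // codom_f.
  by exists (enum_rank_in aZ (enum_rank_in iB (iota i))); rewrite !enum_rankK_in.
have [f fE] := choice ex_f.
exists f; split; last by move=> i j; rewrite [RHS]mxE schurE !fE entry.
apply: inj_card_bij => [i j E|].
  by apply: inj; rewrite -!fE E.
rewrite !card_ord -(card_imset _ (@enum_val_inj _ (mem (~: B)))).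
have : (#|[set enum_val a | a in Z]| <= #|codom iota|)%N.
  apply/subset_leq_card/subsetP=> w /imsetP[a]; by rewrite inE => aZ ->.
by rewrite card_codom // card_ord.
Qed.

Lemma boundary_relT k n (M : 'M[F]_n) x y :
  boundary_rel (k := k) M setT x y (0, 0) <-> y = M *m x.
Proof.
have P0 : frameP k M setT = 0.
  rewrite -framePE; last by rewrite lamT.
  by rewrite /frameE cutE setCT pr0 mulmx0 mxrank0 pid_mx_0 mulmx0.
rewrite /boundary_rel P0 /= prT !mul1mx mul0mx addr0 mulmx1 trmx0 mul0mx mulmx0.
by split=> [[]|->].
Qed.

Lemma bminor_schur k n n' (M : 'M[F]_n) (M' : 'M[F]_n') : M'^T = eps *: M' ->
    bminor (k := k) M M' setT setT id ->
  exists Y : {set 'I_n'}, principal_submatrix M' Y \in unitmx /\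
    exists Z : {set 'I_#|~: Y|},
      matrix_isomorphic M (principal_submatrix (schur_complement M' Y) Z).
Proof.
move=> symM' [iota [S [inj _ rel]]].
have inj' : injective iota by move=> i j; apply: inj; rewrite inE.
have cod j : (j \notin codom iota) = (j \in setT :\: iota @: setT).
  rewrite !inE andbT; congr (~~ _); apply/codomP/imsetP => [[i ->]|[i _ ->]]; by exists i.
apply: (@minor_schur _ _ _ _ iota S symM' inj') => x y; split.
  move=> /(boundary_relT k)/rel[x' [y' [/boundary_relT Ey keep out]]].
  exists x'; rewrite -Ey; split=> [i|i|j]; try by case: (keep i).
  by rewrite cod => /out.
case=> x' [kx ky out]; apply/(boundary_relT k)/rel.
exists x', (M' *m x'); split=> [|//|j]; first exact/boundary_relT.
by rewrite -cod => /out.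
Qed.

End SchurExtraction.

(** * From rank-decompositions to binary trees *)

Section TreeEdges.
Variables (V : finType) (e : rel V).
Hypothesis e_tree : is_tree e.

Let e_sym : symmetric e. Proof. by case: e_tree. Qed.
Let e_irr : irreflexive e. Proof. by case: e_tree. Qed.

Definition side u v x : bool := connect (delete_edge e u v) u x.

Lemma delete_edge_sub u v : subrel (delete_edge e u v) e.
Proof. by move=> x y /and3P[]. Qed.

Lemma delete_edgeC u v : delete_edge e u v =2 delete_edge e v u.
Proof. by move=> x y; rewrite /delete_edge; congr andb; exact: andbC. Qed.

Lemma path_delete u v w p : u \notin w :: p -> path e w p -> path (delete_edge e u v) w p.
Proof.
elim: p w => //= x p IH w; rewrite !inE !negb_or => /and3P[uw ux up] /andP[wx px].
rewrite IH ?inE ?negb_or ?ux // andbT /delete_edge wx !xpair_eqE.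
by rewrite [w == u]eq_sym (negbTE uw) [x == u]eq_sym (negbTE ux) andbF.
Qed.

Lemma edge_not_side u v : e u v -> ~~ side u v v.
Proof.
move=> uv; apply/negP=> /connectP[p0 path0 last0].
case/shortenP: path0 last0 => p pathp uniqp _ lastp.
have [_ _ _ _ acyc] := e_tree.
have cyc : ucycle e (u :: p).
  rewrite /ucycle uniqp andbT /= rcons_path -lastp e_sym uv andbT.
  exact: sub_path (@delete_edge_sub u v) _ _ pathp.
have := acyc _ cyc; case: p {cyc} lastp uniqp pathp => [|w [|w' p]] //=.
  by move=> vu _ _; move: uv; rewrite vu e_irr.
by move=> -> _; rewrite /delete_edge eqxx andbF.
Qed.

Lemma sideP u v x : e u v ->
  reflect (exists p, [/\ path e u p, last u p = x, uniq (u :: p) & v \notin u :: p])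
    (side u v x).
Proof.
move=> uv; apply: (iffP idP) => [/connectP[p0 path0 ->]|[p [pathp <- _ vp]]].
  case/shortenP: path0 => p pathp uniqp _; exists p; split=> //.
    exact: sub_path (@delete_edge_sub u v) _ _ pathp.
  apply: contra (edge_not_side uv); rewrite inE => /orP[/eqP vu|vp].
    by rewrite vu e_irr in uv.
  case/splitPr: vp pathp => p1 p2; rewrite cat_path /= => /and3P[h1 h2 _].
  by apply/connectP; exists (rcons p1 v); rewrite ?last_rcons // rcons_path h1.
apply/connectP; exists p => //; rewrite (eq_path (delete_edgeC u v)).
exact: path_delete.
Qed.

Lemma side_excl u v x : e u v -> side u v x -> ~~ side v u x.
Proof.
move=> uv ux; apply: contra (edge_not_side uv) => vx.
apply: connect_trans ux _; move: vx; rewrite /side (eq_connect (delete_edgeC v u)).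
rewrite (sym_connect_sym _) // => a b; rewrite /delete_edge e_sym; congr andb.
by rewrite andbC !xpair_eqE; congr (~~ _ && ~~ _); exact: andbC.
Qed.

Lemma side_total u v x : e u v -> side u v x || side v u x.
Proof.
move=> uv; have [_ _ _ conn _] := e_tree.
case/connectP: (conn u x) => p0 path0 ->; case/shortenP: path0 => p pathp uniqp _.
case: p pathp uniqp => [|w p] /=; first by rewrite /side connect0.
case/andP=> uw pathp /andP[up uniqp].
have [wv|wv] := eqVneq w v.
  apply/orP; right; apply/connectP; exists p; last by rewrite wv.
  rewrite (eq_path (delete_edgeC v u)) -wv; exact: path_delete.
apply/orP; left; apply/connectP; exists (w :: p) => //=.
rewrite path_delete // andbT /delete_edge uw !xpair_eqE eqxx (negbTE wv) /=.
by apply: contra up => /andP[_ /eqP <-]; rewrite mem_head.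
Qed.

Lemma side_disjoint v w w' x : e v w -> e v w' -> w != w' -> side w v x -> ~~ side w' v x.
Proof.
move=> vw vw' ww' wx; apply/negP; have w'v : e w' v by rewrite e_sym.
case/(sideP _ w'v) => p [pathp lastp _ vp].
have : side v w x.
  apply/connectP; exists (w' :: p) => //=; rewrite path_delete // andbT.
  rewrite /delete_edge vw' !xpair_eqE eqxx /= eq_sym ww' /=.
  by apply: contra ww' => /andP[/eqP Evw _]; rewrite Evw e_irr in vw.
by apply/negP; apply: side_excl wx; rewrite e_sym.
Qed.

(** The recursion that turns the component behind an edge into a rooted tree. *)
Lemma side_rec u v x : e u v ->
  side v u x = (x == v) || [exists w, [&& e v w, w != u & side w v x]].
Proof.
move=> uv; have vu : e v u by rewrite e_sym.
apply/idP/orP => [/(sideP _ vu)[[|w p] /= [pathp lastp uniqp up]]|].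
- by left; rewrite -lastp.
- right; apply/existsP; exists w; case/andP: pathp => vw pathp.
  move: up; rewrite !inE !negb_or => /and3P[_ uw up]; rewrite vw eq_sym uw /=.
  have wv : e w v by rewrite e_sym.
  apply/(sideP _ wv); exists p; case/andP: uniqp => vp uniqp; split=> //.
- case=> [/eqP ->|/existsP[w /and3P[vw wu wx]]]; first exact: connect0.
  have wv : e w v by rewrite e_sym.
  case/(sideP _ wv): (wx) => p [pathp lastp uniqp vp].
  apply/(sideP _ vu); exists (w :: p); split=> //=; first by rewrite vw.
    by rewrite vp.
  rewrite inE negb_or; apply/andP; split.
    by apply: contraTneq uv => ->; rewrite e_irr.
  have uu : side u v u by exact: connect0.
  apply/negP=> ux; have := side_disjoint vu vw _ uu; rewrite eq_sym => /(_ wu).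
  case/negP; move: ux; rewrite inE => /orP[/eqP ->|ux]; first exact: connect0.
  apply/(sideP _ wv); case/splitPr: ux pathp uniqp vp => p1 p2.
  rewrite cat_path /= => /and3P[h1 h2 _] uq vp; exists (rcons p1 u).
  rewrite rcons_path h1 h2 last_rcons; split=> //.
    move: uq; rewrite -cat_rcons mem_cat negb_or cat_uniq.
    by case/andP=> /andP[wn _] /andP[un _]; rewrite /= wn.
  by apply: contra vp => vp; rewrite -cat_rcons -cat_cons mem_cat vp.
Qed.

Lemma side_proper u v w : e u v -> e v w -> w != u ->
  [set x | side w v x] \proper [set x | side v u x].
Proof.
move=> uv vw wu; apply/properP; split.
  apply/subsetP=> x; rewrite !inE (side_rec x uv) => wx; apply/orP; right.
  by apply/existsP; exists w; rewrite vw wu.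
exists v; rewrite inE; first exact: connect0.
by apply: edge_not_side; rewrite e_sym.
Qed.

End TreeEdges.

Section TreeOfDecomposition.
Variables (F : fieldType) (n k : nat) (A : 'M[F]_n) (D : rank_decomposition n).
Hypothesis Dk : decomposition_width A D <= k.
Local Notation e := (@rd_adj n D).
Local Notation V := (rd_vertex D).

Let e_tree : is_tree e. Proof. by case: (rd_subcubic D). Qed.

Let e_sym : symmetric e. Proof. by case: e_tree. Qed.

Lemma edge_sideC (u v : V) : e u v -> edge_side v u = ~: edge_side u v.
Proof.
move=> uv; apply/setP=> i; rewrite !inE.
have := side_total e_tree (val (rd_leaf D i)) uv.
have := @side_excl _ _ e_tree u v (val (rd_leaf D i)) uv.
rewrite /side; case: (connect _ u _) => [/(_ isT)/negbTE -> //|_] /= ->.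
by [].
Qed.

Lemma lam_edge_side (u v : V) : e u v -> lam A (edge_side u v) <= k.
Proof.
move=> uv; rewrite /lam /rho -edge_sideC // -rank_submatrix.
apply: leq_trans Dk; rewrite /decomposition_width.
exact: (@leq_bigmax_cond _ (fun p : V * V => e p.1 p.2)
  (fun p : V * V => edge_width A p.1 p.2) (u, v) uv).
Qed.

(** Induction on the component of [v]. A leaf becomes a [Leaf], a vertex of degree 3 a [Node], and a
    vertex of degree 2 is skipped, as it cuts off the same indices as its successor. *)
Lemma tree_of_edge (u v : V) : e u v -> exists T : dtree 'I_n,
  [/\ leaves T = edge_side v u, disjoint_leaves T & width_le (lam A) k T].
Proof.
have [m] := ubnP #|[set x | side e v u x]|; elim: m u v => // m IH u v ltm uv.
have vu : e v u by rewrite e_sym.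
have rec i : (i \in edge_side v u) = (val (rd_leaf D i) == v) ||
    [exists w, [&& e v w, w != u & i \in edge_side w v]].
  rewrite inE -/(side e v u _) side_rec //; congr (_ || _).
  by apply: eq_existsb => w; rewrite inE.
have [lv|nlv] := boolP (is_leaf e v).
  have [g gK Kg] := rd_leaf_bij D.
  pose i := g (Sub v lv); have iv : val (rd_leaf D i) = v by rewrite Kg.
  have Es : edge_side v u = [set i].
    apply/setP=> j; rewrite rec inE.
    have -> : [exists w, [&& e v w, w != u & j \in edge_side w v]] = false.
      apply/existsP=> -[w /and3P[vw wu _]].
      case/cards1P: (lv) => a Ea; have : w \in [set a] by rewrite -Ea inE.
      have : u \in [set a] by rewrite -Ea inE.
      by move=> /set1P ua /set1P wa; rewrite ua wa eqxx in wu.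
    rewrite orbF -iv; apply/eqP/eqP => [/val_inj/(can_inj gK)//|->//].
  exists (Leaf i true); split=> //=.
  by rewrite width_leE /= -Es lam_edge_side.
have leafv i : (val (rd_leaf D i) == v) = false.
  by apply: contraNF nlv => /eqP <-; exact: valP.
have deg : 0 < #|[set w | e v w] :\ u| <= 2.
  have := (rd_subcubic D).2 v; move: nlv; rewrite /is_leaf /degree.
  rewrite (cardsD1 u) inE vu; lia.
have child w : w \in [set w | e v w] :\ u -> exists T : dtree 'I_n,
    [/\ leaves T = edge_side w v, disjoint_leaves T & width_le (lam A) k T].
  rewrite !inE => /andP[wu vw]; apply: IH => //.
  by apply: leq_trans (proper_card (side_proper e_tree uv vw wu)) _; rewrite -ltnS.
have /orP[/cards1P[w Ew]|/cards2P[w [w' [ww' Ew]]]] :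
    (#|[set w | e v w] :\ u| == 1) || (#|[set w | e v w] :\ u| == 2).
  by case: #|_| deg => [|[|[]]].
- have [|T [lT dT wT]] := child w; first by rewrite Ew set11.
  exists T; split=> //; rewrite lT; apply/setP=> i; rewrite rec leafv /=.
  apply/idP/existsP => [iw|[x /and3P[vx xu ix]]].
    have : w \in [set w] by rewrite set11.
    by rewrite -Ew !inE => /andP[wu vw]; exists w; rewrite vw wu.
  have : x \in [set w] by rewrite -Ew !inE xu.
  by move=> /set1P <-.
have [|T [lT dT wT]] := child w; first by rewrite Ew !inE eqxx.
have [|T' [lT' dT' wT']] := child w'; first by rewrite Ew !inE eqxx orbT.
have [wu vw] : w != u /\ e v w.
  have : w \in [set w; w'] by rewrite !inE eqxx.
  by rewrite -Ew !inE => /andP.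
have [w'u vw'] : w' != u /\ e v w'.
  have : w' \in [set w; w'] by rewrite !inE eqxx orbT.
  by rewrite -Ew !inE => /andP.
have Es : edge_side w v :|: edge_side w' v = edge_side v u.
  apply/setP=> i; rewrite inE rec leafv /=; apply/orP/existsP => [[iw|iw']|].
  - by exists w; rewrite vw wu.
  - by exists w'; rewrite vw' w'u.
  - case=> x /and3P[vx xu ix]; have : x \in [set w; w'] by rewrite -Ew !inE xu.
    by rewrite !inE => /orP[] /eqP Ex; [left|right]; move: ix; rewrite Ex inE.
exists (Node T T'); split=> /=; first by rewrite lT lT'.
  rewrite dT dT' lT lT' !andbT -setI_eq0; apply/eqP/setP=> i; rewrite !inE.
  apply/negbTE/negP=> /andP[iw]; apply/negP.
  exact: side_disjoint e_tree _ _ _ _ vw vw' ww' iw.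
by rewrite width_leE wT wT' /= lT lT' Es lam_edge_side.
Qed.

End TreeOfDecomposition.

Lemma tree_of_rank_width (F : fieldType) n k (A : 'M[F]_n) : 0 < n -> rank_width A <= k ->
  exists T : dtree 'I_n,
    [/\ leaves T = setT, disjoint_leaves T & width_le (lam A) k T].
Proof.
move=> n0; rewrite /rank_width; case: ex_minnP => w + _.
rewrite /rank_width_candidate; case: leqP => [n1 _ _|n2 /asboolP[D <-] Dk].
  have i : 'I_n by exact: Ordinal n0.
  have Ei : [set i] = setT.
    by apply/eqP; rewrite eqEcard subsetT cardsT card_ord cards1.
  by exists (Leaf i true); rewrite width_leE /= Ei lamT.
(* The binary tree is rooted on the edge at the leaf of index 0, and the trees of its two sides are
   joined. *)
pose u := val (rd_leaf D (Ordinal n0)).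
have /cards1P[v Ev] : is_leaf (@rd_adj n D) u by exact: valP.
have uv : rd_adj u v by have : v \in [set v] by [rewrite set11]; rewrite -Ev inE.
have vu : rd_adj v u by case: (rd_subcubic D) => [[_ <-]].
have [T [lT dT wT]] := tree_of_edge Dk uv.
have [T' [lT' dT' wT']] := tree_of_edge Dk vu.
have lTT' : leaves T :|: leaves T' = setT.
  by rewrite lT lT' (edge_sideC vu) setUCr.
exists (Node T T'); split=> //=.
  by rewrite dT dT' lT lT' (edge_sideC vu) !andbT -setI_eq0 setICr.
by rewrite width_leE wT wT' /= lTT' lamT.
Qed.

(** * Assembly of the theorem *)

Lemma good_item (F : finFieldType) (k n : nat) (eps : F) (M : 'M[F]_n) :
    (eps * eps = 1)%R -> 0 < n -> (M^T = eps *: M)%R -> rank_width M <= k ->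
  exists T : dtree 'I_n, good k eps (Item M T) /\ leaves T = setT.
Proof.
move=> eps2 n0 symM wM; have [T0 [l0 d0 w0]] := tree_of_rank_width n0 wM.
have lamC X : lam M (~: X) = lam M X by exact: lamC eps2 symM.
have [T [lT dT wT linkT]] := exists_linked_tree lamC (lam_submod M) (lam0 M) d0 w0.
by exists T; split; [split|rewrite lT].
Qed.

Lemma eps_symmetric_wqo (F : finFieldType) (k : nat) (eps : F) (n : nat -> nat)
    (M : forall i : nat, 'M[F]_(n i)) :
    (eps * eps = 1)%R -> (forall i, 0 < n i) -> (forall i, ((M i)^T = eps *: M i)%R) ->
    (forall i, rank_width (M i) <= k) ->
  exists i j : nat, i < j /\
    exists Y : {set 'I_(n j)},
      principal_submatrix (M j) Y \in unitmx /\
      exists Z : {set 'I_#|~: Y|},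
        matrix_isomorphic (M i)
          (principal_submatrix (schur_complement (M j) Y) Z).
Proof.
move=> eps2 n0 symM wM.
have exT i : exists e : item F, exists2 T, e = Item (M i) T &
    good k eps e /\ leaves T = setT.
  have [T HT] := good_item eps2 (n0 i) (symM i) (wM i).
  by exists (Item (M i) T), T.
have [f fP] := choice exT.
have [i [j [ij]]] : exists i j, i < j /\ le_id k (f i) (f j).
  by apply: (good_wqo eps2) => i; have [T _ []] := fP i.
have [T -> [_ lT]] := fP i; have [T' -> [_ lT']] := fP j.
rewrite /le_id /le_twist /item_set /= lT lT' => minor.
by exists i, j; split=> //; exact: (@bminor_schur F eps eps2 k _ _ _ _ (symM j) minor).
Qed.

(** Matrices of order 0 are set apart because a [dtree] over an empty type has no inhabitant. *)
Lemma empty_matrix_minor (F : fieldType) m n (A : 'M[F]_m) (B : 'M[F]_n) : m = 0 ->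
  exists Y : {set 'I_n}, principal_submatrix B Y \in unitmx /\
    exists Z : {set 'I_#|~: Y|},
      matrix_isomorphic A (principal_submatrix (schur_complement B Y) Z).
Proof.
move=> m0; exists set0; split.
  rewrite -row_free_unit /row_free eqn_leq rank_leq_row.
  by rewrite [X in X <= _]cards0.
exists set0; have no (i : 'I_m) : False by case: i => i; rewrite m0.
have no' (z : 'I_#|set0 : {set 'I_#|~: (set0 : {set 'I_n})|}|) : False.
  by case: z => z; rewrite cards0.
exists (fun i => False_rect _ (no i)); split; last by move=> i; case: (no i).
by exists (fun z => False_rect _ (no' z)) => i; [case: (no i)|case: (no' i)].
Qed.

Theorem theorem7p1 (F : finFieldType) (k : nat) (n : nat -> nat)
    (M : forall i : nat, 'M[F]_(n i)) :
  (forall i, skew_symmetric_matrix (M i) \/ symmetric_matrix (M i)) ->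
  (forall i, rank_width (M i) <= k) ->
  exists i j : nat, i < j /\
    exists Y : {set 'I_(n j)},
      principal_submatrix (M j) Y \in unitmx /\
      exists Z : {set 'I_#|~: Y|},
        matrix_isomorphic (M i)
          (principal_submatrix (schur_complement (M j) Y) Z).
Proof.
move=> symM wM.
have [[i n0]|pos] := pselect (exists i, n i = 0).
  by exists i, i.+1; split=> //; exact: empty_matrix_minor.
have n0 i : 0 < n i by rewrite lt0n; apply/eqP=> ni; apply: pos; exists i.
have sub (g : nat -> nat) (eps : F) : (forall i j, i < j -> g i < g j) ->
    (eps * eps = 1)%R -> (forall i, ((M (g i))^T = eps *: M (g i))%R) ->
    exists i j : nat, i < j /\ exists Y : {set 'I_(n j)},
      principal_submatrix (M j) Y \in unitmx /\ exists Z : {set 'I_#|~: Y|},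
        matrix_isomorphic (M i) (principal_submatrix (schur_complement (M j) Y) Z).
  move=> g_incr eps2 symg.
  have [i [j [ij H]]] := @eps_symmetric_wqo F k eps (n \o g) (fun i => M (g i)) eps2
    (fun i => n0 _) symg (fun i => wM _).
  by exists (g i), (g j); split; [exact: g_incr|].
(* Either a subsequence is symmetric, with [eps = 1], or a whole tail is skew-symmetric, with
   [eps = -1]. *)
have [inf|] := pselect (infinitely_often (fun i => symmetric_matrix (M i))).
  have [g g_incr symg] := infinitely_often_subseq inf.
  by apply: (sub g 1%R g_incr) => [|i]; rewrite ?mulr1 // scale1r -symg.
move/existsNP=> [N skew]; apply: (sub (addn N) (- 1)%R) => [i j||i].
- by rewrite ltn_add2l.
- by rewrite mulrNN mulr1.
case: (symM (N + i)) => [[E _]|symi]; first by rewrite scaleN1r [in RHS]E opprK.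
by case: skew; exists (N + i); rewrite ?leq_addr.
Qed.
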